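(* Let $k$ be a natural number. A scheme is smooth of dimension $k$ if and only if it has a finite open cover by standard smooth schemes of dimension $k$.
   Context: We work in homotopy type theory with univalent universes and propositional truncation (neither excluded middle nor the axiom of choice is assumed). ''Merely'', ''there exists'', ''has'' and disjunction refer to propositional truncation; a map is surjective if its fibers are merely inhabited. Fix a commutative ring $R$. A finitely presented $R$-algebra is one merely of the form $R[X_1,\dots,X_n]/(P_1,\dots,P_l)$; for such $A$, $\mathrm{Spec}(A)$ is the type of $R$-algebra homomorphisms $A\to R$, and for $a:A$, $x:\mathrm{Spec}(A)$ one writes $a(x)=x(a)$. A Zariski-cover of $\mathrm{Spec}(A)$ is a finite family of subtypes $U_i=\{x\mid f_i(x)\text{ invertible}\}$ with $f_1,\dots,f_n:A$ generating the unit ideal. Axioms: (Locality) $R$ is local: $1\neq 0$, and if $x+y$ is invertible then $x$ or $y$ is invertible. (Duality) For every finitely presented $R$-algebra $A$ the map $A\to(\mathrm{Spec}(A)\to R)$, $a\mapsto(\varphi\mapsto\varphi(a))$ is an isomorphism of $R$-algebras. (Zariski-local choice) For every finitely presented $R$-algebra $A$ and family $B$ of merely inhabited types over $\mathrm{Spec}(A)$, there merely exist a Zariski-cover $U_1,\dots,U_n$ of $\mathrm{Spec}(A)$ and dependent functions $s_i:(x:U_i)\to B(x)$. A proposition is open if it is merely of the form $r_1\neq 0\vee\dots\vee r_n\neq 0$ with $r_i:R$, and closed if merely of the form $r_1=0\wedge\dots\wedge r_n=0$. A subtype $U$ of a type $X$ is open if $x\in U$ is an open proposition for all $x:X$. An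 affine scheme is a type merely of the form $\mathrm{Spec}(A)$ with $A$ a finitely presented $R$-algebra; a scheme is a type that merely has a finite cover by open subtypes that are affine schemes. A closed proposition is dense (closed dense) if it is merely of the form $r_1=0\wedge\dots\wedge r_n=0$ with all $r_i$ nilpotent. A type $X$ is formally smooth if for every closed dense proposition $P$ the map $X\to X^P$ sending $x$ to the constant map is surjective. A smooth scheme is a scheme which is formally smooth as a type. Let $\mathbb{D}(1)=\{\epsilon:R\mid\epsilon^2=0\}$ and $\mathbb{D}(2)=\{(a,b):R^2\mid a^2=ab=b^2=0\}$. For a scheme $X$ and $x:X$, the tangent space $T_x(X)=\{t:\mathbb{D}(1)\to X\mid t(0)=x\}$ is an $R$-module with $(rv)(\epsilon)=v(r\epsilon)$ and $(v+w)(\epsilon)=\psi_{v,w}(\epsilon,\epsilon)$, where $\psi_{v,w}:\mathbb{D}(2)\to X$ is the unique pointed map (sending $0$ to $x$) restricting to $v$ and $w$ on the two axes. A scheme is smooth of dimension $n$ if it is smooth and all its tangent spaces are finite free of dimension $n$ (merely isomorphic to $R^n$). A standard smooth scheme of dimension $k$ is an affine scheme (merely) of the form $\mathrm{Spec}(R[X_1,\dots,X_n,Y_1,\dots,Y_k]/(P_1,\dots,P_n))$ where the determinant of $\left(\frac{\partial P_i}{\partial X_j}\right)_{1\leq i,j\leq n}$ is invertible in $R[X_1,\dots,X_n,Y_1,\dots,Y_k]/(P_1,\dots,P_n)$. *)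

(* Defs.v *)
(* The type theory is that of Rocq without classical axioms.  Its universe Prop
   plays the role of the type of propositions: "merely", "there exists" and
   disjunction are [inhabited], [exists] and [\/].  The algebraic structures of
   MathComp cannot be used for the base ring, because they come with a decidable
   equality, which is incompatible with duality; only finite ordinals, big
   operators and permutations are taken from there.  The axioms of synthetic
   algebraic geometry are propositions on the base ring, to be taken as
   hypotheses; they are refuted by excluded middle. *)

From Stdlib Require Import Ring_theory ClassicalFacts ChoiceFacts.
From mathcomp Require Import ssreflect ssrfun ssrbool eqtype ssrnat seq.
From mathcomp Require Import choice fintype bigop fingroup perm.

Set Implicit Arguments.
Unset Strict Implicit.
Unset Printing Implicit Defensive.

(* Theorems of homotopy type theory (consequences of univalence and of the
   elimination of truncations into propositions) on which Rocq's Prop is silent. *)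
Record extensional_setting : Type := ExtensionalSetting {
  setting_funext : forall (A : Type) (B : A -> Type) (f g : forall x, B x),
    (forall x, f x = g x) -> f = g;
  setting_propext : prop_extensionality;
  setting_unique_choice : forall A : Type, ConstructiveDefiniteDescription_on A
}.

Declare Scope cring_scope.
Delimit Scope cring_scope with cring.

Record cring : Type := CRing {
  cring_sort :> Type;
  rzero : cring_sort;
  rone : cring_sort;
  radd : cring_sort -> cring_sort -> cring_sort;
  rmul : cring_sort -> cring_sort -> cring_sort;
  ropp : cring_sort -> cring_sort;
  cring_laws :
    ring_theory rzero rone radd rmul (fun x y => radd x (ropp y)) ropp eq
}.

Bind Scope cring_scope with cring_sort.
Arguments rzero {c}.
Arguments rone {c}.
Notation "0" := rzero : cring_scope.
Notation "1" := rone : cring_scope.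
Infix "+" := radd : cring_scope.
Infix "*" := rmul : cring_scope.
Notation "- x" := (ropp x) : cring_scope.
Local Open Scope cring_scope.

Definition rsum (A : cring) (n : nat) (F : 'I_n -> A) : A :=
  \big[@radd A/0]_(i < n) F i.

Definition rexp (A : cring) (x : A) (m : nat) : A := iter m (rmul x) 1.

Definition rdet (A : cring) (n : nat) (M : 'I_n -> 'I_n -> A) : A :=
  \big[@radd A/0]_(s : 'S_n)
    let p := \big[@rmul A/1]_(i < n) M i (s i) in
    if odd_perm s then - p else p.

Definition invertible (A : cring) (x : A) : Prop := exists y, x * y = 1.

Definition nilpotent (A : cring) (x : A) : Prop := exists m, rexp x m = 0.

Definition generates_unit_ideal (A : cring) (n : nat) (f : 'I_n -> A) : Prop :=
  exists c : 'I_n -> A, rsum (fun i => c i * f i) = 1.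

Record ring_hom (A B : cring) (f : A -> B) : Prop := RingHom {
  ring_hom_add : forall x y, f (x + y) = f x + f y;
  ring_hom_mul : forall x y, f (x * y) = f x * f y;
  ring_hom_one : f 1 = 1
}.

Record algebra (R : cring) : Type := Algebra {
  algebra_ring :> cring;
  structure_map : R -> algebra_ring;
  structure_map_hom : ring_hom structure_map
}.

Lemma id_ring_hom (R : cring) : ring_hom (fun r : R => r).
Proof. by []. Qed.

Definition regular_algebra (R : cring) : algebra R := Algebra (id_ring_hom R).

Record algebra_hom (R : cring) (A B : algebra R) (f : A -> B) : Prop :=
  AlgebraHom {
    algebra_hom_ring :> ring_hom f;
    algebra_hom_scalar : forall r, f (structure_map A r) = structure_map B r
  }.

Record Spec (R : cring) (A : algebra R) : Type := SpecPoint {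
  spec_fun :> A -> regular_algebra R;
  spec_hom : algebra_hom spec_fun
}.

(* The polynomial ring R[X_0, ..., X_(n-1)], as the free commutative R-algebra:
   ring expressions, modulo the congruence [peq] generated by the ring axioms
   and by the compatibility with the operations of R. *)
Inductive poly (R : cring) (n : nat) : Type :=
| PConst of R
| PVar of 'I_n
| PAdd of poly R n & poly R n
| PMul of poly R n & poly R n
| POpp of poly R n.

Arguments PConst {R} n _.
Arguments PVar R {n} _.

Inductive peq (R : cring) (n : nat) : poly R n -> poly R n -> Prop :=
| peq_refl p : peq p p
| peq_sym p q : peq p q -> peq q p
| peq_trans p q r : peq p q -> peq q r -> peq p r
| peq_add p p' q q' : peq p p' -> peq q q' -> peq (PAdd p q) (PAdd p' q')
| peq_mul p p' q q' : peq p p' -> peq q q' -> peq (PMul p q) (PMul p' q')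
| peq_opp p p' : peq p p' -> peq (POpp p) (POpp p')
| peq_const_add a b :
    peq (PConst n (a + b)) (PAdd (PConst n a) (PConst n b))
| peq_const_mul a b :
    peq (PConst n (a * b)) (PMul (PConst n a) (PConst n b))
| peq_addA p q r : peq (PAdd p (PAdd q r)) (PAdd (PAdd p q) r)
| peq_addC p q : peq (PAdd p q) (PAdd q p)
| peq_add0 p : peq (PAdd (PConst n 0) p) p
| peq_addN p : peq (PAdd p (POpp p)) (PConst n 0)
| peq_mulA p q r : peq (PMul p (PMul q r)) (PMul (PMul p q) r)
| peq_mulC p q : peq (PMul p q) (PMul q p)
| peq_mul1 p : peq (PMul (PConst n 1) p) p
| peq_mulDl p q r : peq (PMul (PAdd p q) r) (PAdd (PMul p r) (PMul q r)).

Fixpoint peval (R : cring) (n : nat) (A : algebra R) (a : 'I_n -> A)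
    (p : poly R n) : A :=
  match p with
  | PConst r => structure_map A r
  | PVar i => a i
  | PAdd p q => peval a p + peval a q
  | PMul p q => peval a p * peval a q
  | POpp p => - peval a p
  end.

Fixpoint pderiv (R : cring) (n : nat) (j : 'I_n) (p : poly R n) : poly R n :=
  match p with
  | PConst _ => PConst n 0
  | PVar i => PConst n (if i == j then 1 else 0)
  | PAdd p q => PAdd (pderiv j p) (pderiv j q)
  | PMul p q => PAdd (PMul (pderiv j p) q) (PMul p (pderiv j q))
  | POpp p => POpp (pderiv j p)
  end.

Definition in_ideal (R : cring) (n l : nat) (P : 'I_l -> poly R n)
    (p : poly R n) : Prop :=
  exists c : 'I_l -> poly R n,
    peq p (\big[@PAdd R n/PConst n 0]_(j < l) PMul (c j) (P j)).

(* Evaluation at [a] induces an isomorphism R[X_0, ..., X_(n-1)]/(P) -> A. *)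
Record presents (R : cring) (n l : nat) (P : 'I_l -> poly R n)
    (A : algebra R) (a : 'I_n -> A) : Prop := Presents {
  presents_surj : forall x : A, exists p, peval a p = x;
  presents_ker : forall p, peval a p = 0 <-> in_ideal P p
}.

Definition finitely_presented (R : cring) (A : algebra R) : Prop :=
  exists (n l : nat) (P : 'I_l -> poly R n) (a : 'I_n -> A), presents P a.

Definition locality (R : cring) : Prop :=
  (1 : R) <> 0 /\
  forall x y : R, invertible (x + y) -> invertible x \/ invertible y.

(* As each point of Spec(A) is a homomorphism, the map is one of R-algebras for
   the pointwise structure on functions; it is an isomorphism once bijective. *)
Definition duality (R : cring) : Prop :=
  forall A : algebra R, finitely_presented A ->
    bijective (fun (a : A) (x : Spec A) => x a).

Definition zariski_local_choice (R : cring) : Prop :=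
  forall A : algebra R, finitely_presented A ->
  forall B : Spec A -> Type, (forall x, inhabited (B x)) ->
  exists (n : nat) (f : 'I_n -> A),
    generates_unit_ideal f /\
    inhabited (forall (i : 'I_n) (x : Spec A), invertible (x (f i)) -> B x).

Definition open_prop (R : cring) (P : Prop) : Prop :=
  exists (n : nat) (r : 'I_n -> R), P <-> exists i, r i <> 0.

Definition closed_dense_prop (R : cring) (P : Prop) : Prop :=
  exists (n : nat) (r : 'I_n -> R),
    (forall i, nilpotent (r i)) /\ (P <-> forall i, r i = 0).

Definition has_finite_open_cover_by (R : cring) (C : Type -> Prop) (X : Type) :
    Prop :=
  exists (n : nat) (U : 'I_n -> X -> Prop),
    [/\ forall i x, open_prop R (U i x),
        forall x, exists i, U i x &
        forall i, C {x : X | U i x}].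

Definition affine_scheme (R : cring) (X : Type) : Prop :=
  exists A : algebra R, finitely_presented A /\
  exists f : X -> Spec A, bijective f.

Definition scheme (R : cring) (X : Type) : Prop :=
  has_finite_open_cover_by R (affine_scheme R) X.

Definition formally_smooth (R : cring) (X : Type) : Prop :=
  forall P : Prop, closed_dense_prop R P ->
  forall f : P -> X, exists x : X, (fun _ : P => x) = f.

Definition smooth_scheme (R : cring) (X : Type) : Prop :=
  scheme R X /\ formally_smooth R X.

Definition D1 (R : cring) : Type := {e : R | e * e = 0}.

Definition D2 (R : cring) : Type :=
  {ab : R * R | [/\ ab.1 * ab.1 = 0, ab.1 * ab.2 = 0 & ab.2 * ab.2 = 0]}.

Lemma rmul0r (A : cring) (x : A) : x * 0 = 0.
Proof.
have laws := cring_laws A.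
have H : x * 0 + x * 0 = x * 0.
  rewrite (Rmul_comm laws x 0) -(Rdistr_l laws) (Radd_0_l laws).
  by [].
have := congr1 (fun y => y + - (x * 0)) H.
by rewrite -(Radd_assoc laws) (Ropp_def laws) (Radd_comm laws) (Radd_0_l laws).
Qed.

Lemma rmul0l (A : cring) (x : A) : 0 * x = 0.
Proof. by rewrite (Rmul_comm (cring_laws A)) rmul0r. Qed.

Lemma D1_scale_subproof (R : cring) (r e : R) :
  e * e = 0 -> (r * e) * (r * e) = 0.
Proof.
have laws := cring_laws R; move=> He.
rewrite (Rmul_comm laws r e) -(Rmul_assoc laws) (Rmul_comm laws r (e * r)).
by rewrite !(Rmul_assoc laws) He !rmul0l.
Qed.

Definition D1_zero (R : cring) : D1 R := exist _ 0 (rmul0r 0).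

Definition D1_scale (R : cring) (r : R) (e : D1 R) : D1 R :=
  exist _ (r * sval e) (D1_scale_subproof r (svalP e)).

Definition D2_zero (R : cring) : D2 R :=
  exist _ (0, 0) (And3 (rmul0r 0) (rmul0r 0) (rmul0r 0)).

Definition D2_axis1 (R : cring) (e : D1 R) : D2 R :=
  exist _ (sval e, 0) (And3 (svalP e) (rmul0r _) (rmul0r 0)).

Definition D2_axis2 (R : cring) (e : D1 R) : D2 R :=
  exist _ (0, sval e) (And3 (rmul0r 0) (rmul0l _) (svalP e)).

Definition D2_diag (R : cring) (e : D1 R) : D2 R :=
  exist _ (sval e, sval e) (And3 (svalP e) (svalP e) (svalP e)).

Record tangent (R : cring) (X : Type) (x : X) : Type := Tangent {
  tangent_fun :> D1 R -> X;
  tangent_base : tangent_fun (D1_zero R) = x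
}.

(* The operations of T_x(X) are given by their graphs.  The sum of [v] and [w] is
   [fun e => psi (e, e)] for the unique pointed map [psi : D2 -> X] restricting
   to [v] and [w] on the axes. *)
Definition is_tangent_scale (R : cring) (X : Type) (x : X) (r : R)
    (v w : tangent R x) : Prop :=
  forall e : D1 R, w e = v (D1_scale r e).

Definition restricts_to (R : cring) (X : Type) (x : X) (v w : tangent R x)
    (psi : D2 R -> X) : Prop :=
  [/\ psi (D2_zero R) = x,
      forall e, psi (D2_axis1 e) = v e &
      forall e, psi (D2_axis2 e) = w e].

Definition is_tangent_add (R : cring) (X : Type) (x : X)
    (v w s : tangent R x) : Prop :=
  exists psi : D2 R -> X,
    unique (restricts_to v w) psi /\ forall e, s e = psi (D2_diag e).

Definition tangent_free_of_rank (R : cring) (k : nat) (X : Type) (x : X) :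
    Prop :=
  exists phi : ('I_k -> R) -> tangent R x,
    [/\ bijective phi,
        forall r u, is_tangent_scale r (phi u) (phi (fun i => r * u i)) &
        forall u u',
          is_tangent_add (phi u) (phi u') (phi (fun i => u i + u' i))].

Definition smooth_scheme_of_dim (R : cring) (k : nat) (X : Type) : Prop :=
  smooth_scheme R X /\ forall x : X, tangent_free_of_rank R k x.

(* Among the n + k variables, the first n are the X_j and the last k the Y_j.
   The Jacobian determinant is taken in the presented algebra. *)
Definition standard_smooth_scheme (R : cring) (k : nat) (X : Type) : Prop :=
  exists (n : nat) (P : 'I_n -> poly R (n + k)) (A : algebra R)
    (a : 'I_(n + k) -> A),
    [/\ presents P a,
        invertible (rdet (fun i j => peval a (pderiv (lshift k j) (P i)))) &
        exists f : X -> Spec A, bijective f].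

(* Main.v *)
From Stdlib Require Import Ring ClassicalFacts ChoiceFacts.
From HB Require Import structures.
From mathcomp Require Import ssreflect ssrfun ssrbool eqtype ssrnat seq.
From mathcomp Require Import choice fintype finfun bigop finset fingroup perm.
Require Import Defs.

(** Everything is computed on zero loci in affine space. An algebra presented by
    polynomials [P] has the zero locus of [P] as its spectrum ([spec_zeros]); duality
    then says that functions on a zero locus are polynomials ([dual_fun]) and that a
    polynomial vanishing there is in the ideal of the equations ([nullstellensatz]).
    In arity 0 this describes functions on closed propositions and, with locality,
    shows that nonzero elements of [R] are invertible. Hence Gaussian elimination is
    possible: an injective matrix has an invertible maximal minor
    ([linear_inj_minor]). Applied to the first-order neighbourhoods of 0, duality
    identifies the tangent space at a point of a zero locus with the kernel of the
    differential of the equations ([tangent_free_chart]).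

    From standard smooth covers to smoothness. A point defined under a closed dense
    proposition lies in a single member of the cover: this is where local choice is
    needed ([dense_choice], [dense_constant]). In that member, the coordinates of the
    point extend to elements of [R] that satisfy the equations up to nilpotents, and
    the Newton iteration corrects them ([dense_lift]). As the Jacobian matrix is
    invertible, the last [k] coordinates parametrize the kernel of the differential.

    From smoothness to standard smooth covers. On an affine piece in [c + k]
    variables, the kernel of the differential is free of rank [k]. It has a
    complement spanned by basis vectors, on which the differential is injective, so
    some minor of order [c] of the Jacobian matrix is invertible ([minor_cover]).
    There are finitely many minors, and the loci where they are invertible are open.
    On such a locus, the [c] equations of the minor alone define a standard smooth
    scheme, with the same tangent spaces because an injective square matrix is
    surjective ([minor_tangent]). The piece is a closed subscheme of it; formal
    smoothness of the piece shows that its ideal is equal to its square, so that the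
    piece is also open, the locus where some function is invertible
    ([closed_smooth_open]). Inverting a function preserves standard smoothness
    ([localized_regular]), which concludes. *)

Set Implicit Arguments.
Unset Strict Implicit.
Unset Printing Implicit Defensive.

Local Open Scope cring_scope.

(** * Consequences of the extensional setting *)

Section Setting.

Variable setting : extensional_setting.

Lemma proof_irr (P : Prop) (p q : P) : p = q.
Proof.
exact: (ext_prop_dep_proof_irrel_cic (setting_propext setting)).
Qed.

Lemma sval_inj (T : Type) (P : T -> Prop) : injective (@sval T P).
Proof.
by move=> [x px] [y py] /= exy; case: y / exy py => py; rewrite (proof_irr px py).
Qed.

Lemma unique_fun (S T : Type) (Q : S -> T -> Prop) :
  (forall x, exists! y, Q x y) -> {f : S -> T | forall x, Q x (f x)}.
Proof.
move=> H; pose c x := setting_unique_choice setting (H x).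
by exists (fun x => sval (c x)) => x; case: (c x).
Qed.

Lemma inj_surj_bij (S T : Type) (f : S -> T) :
  injective f -> (forall y, exists x, f x = y) -> bijective f.
Proof.
move=> f_inj f_surj.
have uniq_preimage y : exists! x, f x = y.
  by have [x fx] := f_surj y; exists x; split=> // x' fx'; apply: f_inj; rewrite fx.
have [g gK] := unique_fun uniq_preimage.
by exists g => [x|y]; [apply: f_inj | ]; rewrite gK.
Qed.

(** The quotient is the type of equivalence classes, as predicates on [T];
    extensionality makes it effective. *)
Lemma quotient_exists (T : Type) (E : T -> T -> Prop) :
  (forall x, E x x) -> (forall x y, E x y -> E y x) ->
  (forall x y z, E x y -> E y z -> E x z) ->
  exists (Q : Type) (pi : T -> Q),
    (forall q, exists x, pi x = q) /\ (forall x y, pi x = pi y <-> E x y).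
Proof.
move=> Er Es Et.
have cls x : exists y, E x = E y by exists x.
exists {S : T -> Prop | exists x, S = E x}.
exists (fun x => exist _ (E x) (ex_intro _ x erefl)); split.
  by move=> [S [x eS]]; exists x; apply: sval_inj; rewrite /= eS.
move=> x y; split=> [/(congr1 sval) /= -> // | Exy].
apply: sval_inj => /=; apply: (setting_funext setting) => z.
apply: (setting_propext setting); split=> [|Eyz]; first exact/Et/Es.
exact: Et Exy Eyz.
Qed.

End Setting.

(** * Sums and products in a commutative ring *)

Section RingLaws.

Variable A : cring.
Implicit Types x y z : A.

Let laws := cring_laws A.

Fact raddA : associative (@radd A). Proof. exact: (Radd_assoc laws). Qed.
Fact raddC : commutative (@radd A). Proof. exact: (Radd_comm laws). Qed.
Fact radd0l : left_id 0 (@radd A). Proof. exact: (Radd_0_l laws). Qed.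
Fact rmulA : associative (@rmul A). Proof. exact: (Rmul_assoc laws). Qed.
Fact rmulC : commutative (@rmul A). Proof. exact: (Rmul_comm laws). Qed.
Fact rmul1l : left_id 1 (@rmul A). Proof. exact: (Rmul_1_l laws). Qed.
Fact rmulDl : left_distributive (@rmul A) (@radd A).
Proof. move=> x y z; exact: (Rdistr_l laws). Qed.
Fact rmulDr : right_distributive (@rmul A) (@radd A).
Proof. by move=> x y z; rewrite !(rmulC x) rmulDl. Qed.
Fact rmul_0l : left_zero 0 (@rmul A). Proof. exact: rmul0l. Qed.
Fact rmul_0r : right_zero 0 (@rmul A). Proof. exact: rmul0r. Qed.

HB.instance Definition _ := Monoid.isComLaw.Build A 0 (@radd A) raddA raddC radd0l.
HB.instance Definition _ := Monoid.isComLaw.Build A 1 (@rmul A) rmulA rmulC rmul1l.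
HB.instance Definition _ := Monoid.isMulLaw.Build A 0 (@rmul A) rmul_0l rmul_0r.
HB.instance Definition _ :=
  Monoid.isAddLaw.Build A (@rmul A) (@radd A) rmulDl rmulDr.

End RingLaws.

Notation "\sum_ ( i < n ) F" := (\big[@radd _/0]_(i < n) F%cring) : cring_scope.
Notation "\sum_ ( i : I ) F" := (\big[@radd _/0]_(i : I) F%cring) : cring_scope.
Notation "\sum_ i F" := (\big[@radd _/0]_i F%cring) : cring_scope.
Notation "\sum_ ( i | P ) F" := (\big[@radd _/0]_(i | P) F%cring) : cring_scope.
Notation "\prod_ ( i < n ) F" := (\big[@rmul _/1]_(i < n) F%cring) : cring_scope.
Notation "\prod_ i F" := (\big[@rmul _/1]_i F%cring) : cring_scope.

Section RingTheory.

Variable A : cring.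
Implicit Types x y z : A.

Add Ring A_ring : (cring_laws A).

Lemma radd0r x : x + 0 = x. Proof. ring. Qed.
Lemma raddNr x : x + - x = 0. Proof. ring. Qed.
Lemma rsub0 x : x + - 0 = x. Proof. ring. Qed.
Lemma rmul1r x : x * 1 = x. Proof. ring. Qed.

Lemma rmulN1 x : ropp 1 * x = - x. Proof. ring. Qed.

Lemma rmulNl x y : - x * y = - (x * y). Proof. ring. Qed.

Lemma rsub_eq0 x y : x + - y = 0 -> x = y.
Proof. by move=> H; rewrite -[y]radd0l -H; ring. Qed.

Lemma radd_cancel x y z : x + y = x + z -> y = z.
Proof.
move=> H; apply: rsub_eq0; rewrite -(raddNr (x + z)) -{1}H; ring.
Qed.

Lemma radd_eq0 x y : x + y = 0 -> x = - y.
Proof. by move=> H; apply: rsub_eq0; rewrite -H; ring. Qed.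

Lemma rsum_opp (I : finType) (F : I -> A) : \sum_i - F i = - \sum_i F i.
Proof. by apply/esym/(big_morph (@ropp A)) => [x y|]; ring. Qed.

Lemma rsum_mull (I : finType) (F : I -> A) x : x * \sum_i F i = \sum_i x * F i.
Proof. exact: big_distrr. Qed.

Lemma rsum_mulr (I : finType) (F : I -> A) x : (\sum_i F i) * x = \sum_i F i * x.
Proof. exact: big_distrl. Qed.

Lemma rsum_add (I : finType) (F G : I -> A) :
  \sum_i (F i + G i) = \sum_i F i + \sum_i G i.
Proof. exact: big_split. Qed.

Lemma rsum0 (I : finType) (F : I -> A) : (forall i, F i = 0) -> \sum_i F i = 0.
Proof. by move=> F0; apply: big1. Qed.

Lemma rsum_delta (I : finType) (j : I) (F : I -> A) :
  \sum_i (if i == j then 1 else 0) * F i = F j.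
Proof.
rewrite (bigD1 j) //= eqxx rmul1l big1 ?radd0r // => i /negPf ->.
exact: rmul0l.
Qed.

Lemma prod_eq0 (I : finType) (j : I) (F : I -> A) : F j = 0 -> \prod_i F i = 0.
Proof. by move=> Fj; rewrite (bigD1 j) //= Fj rmul0l. Qed.

Lemma invertible_mul x y : invertible x -> invertible y -> invertible (x * y).
Proof.
move=> [x' xx'] [y' yy']; exists (x' * y').
have -> : x * y * (x' * y') = (x * x') * (y * y') by ring.
by rewrite xx' yy'; ring.
Qed.

Lemma invertible_mull x y : invertible (x * y) -> invertible x.
Proof. by move=> [z xyz]; exists (y * z); rewrite -xyz; ring. Qed.

Lemma invertible_mulr x y : invertible (x * y) -> invertible y.
Proof. by rewrite rmulC; apply: invertible_mull. Qed.

Lemma invertible_mul_eq0 x y : invertible x -> x * y = 0 -> y = 0.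
Proof.
move=> [z xz] xy; have -> : y = (x * z) * y by rewrite xz; ring.
have -> : x * z * y = z * (x * y) by ring.
by rewrite xy; ring.
Qed.

Lemma invertible_one : invertible (1 : A). Proof. by exists 1; ring. Qed.

Lemma rexpD x m n : rexp x (m + n) = rexp x m * rexp x n.
Proof.
elim: m => [|m IH]; first by rewrite /= rmul1l.
by rewrite addSn /= -/(rexp x (m + n)) IH rmulA.
Qed.

(** * Determinants *)

Implicit Type n : nat.

Definition sgn (b : bool) : A := if b then ropp 1 else 1.

Lemma sgnM b c : sgn (b (+) c) = sgn b * sgn c.
Proof. by case: b c => [] [] /=; ring. Qed.

Lemma rdetE n (M : 'I_n -> 'I_n -> A) :
  rdet M = \big[@radd _/0]_(s : 'S_n) (sgn (odd_perm s) * \prod_i M i (s i)).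
Proof.
apply: eq_bigr => s _; rewrite /sgn; case: odd_perm => /=; ring.
Qed.

Lemma eq_rdet n (M N : 'I_n -> 'I_n -> A) :
  (forall i j, M i j = N i j) -> rdet M = rdet N.
Proof.
move=> eMN; rewrite !rdetE; apply: eq_bigr => s _.
by congr (_ * _); apply: eq_bigr => i _.
Qed.

Lemma rdet_row_perm n (t : 'S_n) (M : 'I_n -> 'I_n -> A) :
  rdet (fun i => M (t i)) = sgn (odd_perm t) * rdet M.
Proof.
rewrite !rdetE rsum_mull (reindex_inj (mulgI t)) /=.
apply: eq_bigr => s _; rewrite odd_permM sgnM -!rmulA; congr (_ * (_ * _)).
rewrite [RHS](reindex_inj (@perm_inj _ t)) /=.
by apply: eq_bigr => i _; rewrite permM.
Qed.

(** The transposition of the two equal rows matches the even permutations with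
    the odd ones. The terms must be cancelled in pairs, because 2 need not be
    invertible in [A]. *)
Lemma rdet_eq_rows n (i1 i2 : 'I_n) (M : 'I_n -> 'I_n -> A) :
  i1 != i2 -> (forall j, M i1 j = M i2 j) -> rdet M = 0.
Proof.
move=> ne12 eqM; pose F (s : 'S_n) := sgn (odd_perm s) * \prod_i M i (s i).
have F_tperm s : F (tperm i1 i2 * s)%g = - F s.
  have -> : F s = sgn (odd_perm s) * \prod_i M i ((tperm i1 i2 * s)%g i).
    congr (_ * _); rewrite (reindex_inj (@perm_inj _ (tperm i1 i2))) /=.
    by apply: eq_bigr => i _; rewrite permM; case: tpermP => // ->.
  by rewrite /F odd_permM odd_tperm ne12 sgnM -rmulA rmulN1.
rewrite rdetE (bigID (fun s : 'S_n => odd_perm s)) /= -/(F _).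
rewrite [X in X + _](reindex_inj (mulgI (tperm i1 i2))) /=.
rewrite [X in X + _](eq_bigl (fun s : 'S_n => ~~ odd_perm s)); last first.
  by move=> s; rewrite odd_permM odd_tperm ne12.
rewrite -big_split big1 //= => s _.
by rewrite -/(F _) F_tperm -/(F s) raddC raddNr.
Qed.

(** Expand the product by rows: each choice [f] of summands contributes the
    determinant of the rows of [N] selected by [f], which is zero unless [f] is a
    permutation. *)
Lemma rdet_mul n (M N : 'I_n -> 'I_n -> A) :
  rdet (fun i j => \sum_(h < n) M i h * N h j) = rdet M * rdet N.
Proof.
pose F (f : {ffun 'I_n -> 'I_n}) :=
  (\prod_i M i (f i)) * rdet (fun i => N (f i)).
transitivity (\big[@radd _/0]_f F f).
  transitivity (\big[@radd _/0]_(s : 'S_n) \big[@radd _/0]_(f : {ffun 'I_n -> 'I_n})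
      (sgn (odd_perm s) * \prod_i (M i (f i) * N (f i) (s i)))).
    rewrite rdetE; apply: eq_bigr => s _; rewrite -rsum_mull; congr (_ * _).
    exact: (bigA_distr_bigA (fun i h => M i h * N h (s i))).
  rewrite exchange_big /=; apply: eq_bigr => f _.
  rewrite /F rdetE rsum_mull; apply: eq_bigr => s _.
  by rewrite big_split /= rmulA (rmulC (sgn _)) -rmulA.
rewrite (bigID (fun f : {ffun 'I_n -> 'I_n} => injectiveb f)) /=.
rewrite [X in _ + X]big1 ?radd0r => [|f /injectivePn [i [j neij efij]]]; last first.
  by rewrite /F (rdet_eq_rows neij) ?rmul0r // => l; rewrite efij.
rewrite (reindex (fun s : 'S_n => pval s)) /=; last first.
  have s0 : 'S_n by exact: 1%g.
  exists (fun f : {ffun 'I_n -> 'I_n} => insubd s0 f) => [s _ | f].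
    by apply: val_inj; rewrite val_insubd (valP s).
  by move=> f_inj; apply: insubdK.
rewrite (eq_bigl xpredT) => [|s]; last exact: (valP s).
rewrite rdetE rsum_mulr; apply: eq_bigr => s _.
rewrite /F -[pval s]/(val s).
rewrite (eq_rdet (N := fun i => N (s i))) => [|i j]; last by rewrite -pvalE.
rewrite rdet_row_perm rmulA (rmulC _ (sgn _)).
by congr (_ * _ * _); apply: eq_bigr => i _; rewrite -pvalE.
Qed.

Lemma rdet_id_replace_col n (j : 'I_n) (v : 'I_n -> A) :
  rdet (fun i h => if h == j then v i else if i == h then 1 else 0) = v j.
Proof.
rewrite rdetE (bigD1 1%g) //= [X in _ + X]big1 => [|s ne1s].
  rewrite odd_perm1 /sgn (bigD1 j) //= perm1 eqxx big1 => [|i /negPf neij].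
    ring.
  by rewrite perm1 neij eqxx.
have [i nesi] : exists i, s i != i.
  apply/existsP; rewrite -negb_forall; apply: contra ne1s => /forallP s1.
  by apply/eqP/permP => i; rewrite perm1; apply/eqP.
(* A permutation other than the identity moves some point outside of the
   preimage of [j]. *)
have [i' [ne1 ne2]] : exists i', s i' != j /\ s i' != i'.
  have [sij|] := eqVneq (s i) j; last by exists i.
  have nej : s j != j.
    by apply: contraNneq nesi => sj; rewrite sij -(inj_eq (@perm_inj _ s)) sij sj.
  by exists j.
rewrite (prod_eq0 (j := i')) ?rmul0r //.
by rewrite (negPf ne1) eq_sym (negPf ne2).
Qed.

Lemma rdet_id n : rdet (fun i h : 'I_n => if i == h then 1 : A else 0) = 1.
Proof.
case: n => [|n].
  rewrite rdetE (big_pred1 (1%g : 'S_0)) => [|s]; last first.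
    by rewrite /=; apply/esym/eqP/permP => -[].
  by rewrite odd_perm1 big_ord0 /sgn rmul1l.
pose v (i : 'I_n.+1) : A := if i == ord0 then 1 else 0.
transitivity (v ord0); last by [].
rewrite -(rdet_id_replace_col ord0 v).
by apply: eq_rdet => i h; case: (eqVneq h ord0) => [->|].
Qed.

(** Cramer's rule for a zero right-hand side: [M] times the identity matrix with
    column [j] replaced by [v] is [M] with a zero column. *)
Lemma cramer_ker n (M : 'I_n -> 'I_n -> A) (v : 'I_n -> A) :
  (forall i, \sum_(h < n) M i h * v h = 0) -> forall j, rdet M * v j = 0.
Proof.
move=> Mv j; rewrite -[v j](rdet_id_replace_col j v) -rdet_mul rdetE.
apply: rsum0 => s; rewrite (prod_eq0 (j := s^-1%g j)) ?rmul0r // permKV.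
by rewrite -[RHS](Mv (s^-1%g j)); apply: eq_bigr => h _; rewrite eqxx.
Qed.

End RingTheory.

(** * Polynomials: evaluation, directional derivatives, Taylor expansion *)

Section Ideals.

Variable A : cring.

Record is_ideal (I : A -> Prop) : Prop := IsIdeal {
  ideal0 : I 0;
  idealD : forall x y, I x -> I y -> I (x + y);
  idealMl : forall a x, I x -> I (a * x)
}.

Lemma ideal_sum I : is_ideal I -> forall (J : finType) (F : J -> A),
  (forall j, I (F j)) -> I (\sum_j F j).
Proof. by move=> II J F IF; apply: big_ind; [case: II | case: II | ]. Qed.

Lemma zero_ideal : is_ideal (fun x => x = 0).
Proof.
by split=> // [x y -> ->|a x ->]; rewrite ?radd0l ?rmul0r.
Qed.

Lemma family_ideal (J : finType) (f : J -> A) :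
  is_ideal (fun x => exists c : J -> A, x = \sum_j c j * f j).
Proof.
split=> [|x y [c ->] [d ->]|a x [c ->]].
- by exists (fun=> 0); rewrite rsum0 // => j; rewrite rmul0l.
- exists (fun j => c j + d j); rewrite -rsum_add.
  by apply: eq_bigr => j _; rewrite rmulDl.
- by exists (fun j => a * c j); rewrite rsum_mull; apply: eq_bigr => j _; rewrite rmulA.
Qed.

Section Congruence.

Variable (I : A -> Prop) (II : is_ideal I).

Add Ring A_ring_ideal : (cring_laws A).

Lemma ideal_eq x y : I x -> y = x -> I y. Proof. by move=> ? ->. Qed.

Lemma cong_refl x : I (x + - x).
Proof. apply: ideal_eq (ideal0 II) _; ring. Qed.

Lemma cong_sym x y : I (x + - y) -> I (y + - x).
Proof. move=> H; apply: ideal_eq (idealMl II (ropp 1) H) _; ring. Qed.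

Lemma cong_trans x y z : I (x + - y) -> I (y + - z) -> I (x + - z).
Proof. move=> Hxy Hyz; apply: ideal_eq (idealD II Hxy Hyz) _; ring. Qed.

Lemma cong_add x x' y y' : I (x + - x') -> I (y + - y') -> I (x + y + - (x' + y')).
Proof. move=> Hx Hy; apply: ideal_eq (idealD II Hx Hy) _; ring. Qed.

Lemma cong_mul x x' y y' : I (x + - x') -> I (y + - y') -> I (x * y + - (x' * y')).
Proof.
move=> Hx Hy.
apply: ideal_eq (idealD II (idealMl II y Hx) (idealMl II x' Hy)) _; ring.
Qed.

Lemma cong_opp x x' : I (x + - x') -> I (- x + - - x').
Proof. move=> H; apply: ideal_eq (idealMl II (ropp 1) H) _; ring. Qed.

End Congruence.

End Ideals.

Section Polynomials.

Variable R : cring.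

Add Ring R_ring_poly : (cring_laws R).

Section FixedArity.

Variable n : nat.
Implicit Types (p q : poly R n) (y v d : 'I_n -> R).

(** Evaluation in [R] itself; typed in [R] so that ring computations see a single
    carrier. *)
Definition ev y p : R := @peval R n (regular_algebra R) y p.

Lemma ev_const y r : ev y (PConst n r) = r. Proof. by []. Qed.
Lemma ev_var y i : ev y (PVar R i) = y i. Proof. by []. Qed.
Lemma ev_add y p q : ev y (PAdd p q) = ev y p + ev y q. Proof. by []. Qed.
Lemma ev_mul y p q : ev y (PMul p q) = ev y p * ev y q. Proof. by []. Qed.
Lemma ev_opp y p : ev y (POpp p) = - ev y p. Proof. by []. Qed.

Lemma ev_sum y (I : finType) (F : I -> poly R n) :
  ev y (\big[@PAdd R n/PConst n 0]_i F i) = \sum_i ev y (F i).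
Proof. exact: (big_morph (ev y)). Qed.

Definition evE := (ev_const, ev_var, ev_add, ev_mul, ev_opp).

Lemma eq_ev y y' p : (forall i, y i = y' i) -> ev y p = ev y' p.
Proof.
move=> eyy'; elim: p => [r|i|p IHp q IHq|p IHp q IHq|p IHp]; rewrite !evE //;
  by rewrite ?IHp ?IHq.
Qed.

(** The derivative of [p] at [y] in the direction [v]. Jacobian matrices are
    handled through it, because it obeys a chain rule for arbitrary renamings of
    the variables. *)
Definition dev p y v : R := \sum_(j < n) ev y (pderiv j p) * v j.

Lemma dev_const r y v : dev (PConst n r) y v = 0.
Proof. by apply: rsum0 => j; rewrite /= ev_const rmul0l. Qed.

Lemma dev_var i y v : dev (PVar R i) y v = v i.
Proof.
rewrite -[RHS](rsum_delta i v); apply: eq_bigr => j _.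
by rewrite /= ev_const eq_sym.
Qed.

Lemma dev_add p q y v : dev (PAdd p q) y v = dev p y v + dev q y v.
Proof. by rewrite -rsum_add; apply: eq_bigr => j _; rewrite /= ev_add rmulDl. Qed.

Lemma dev_mul p q y v :
  dev (PMul p q) y v = dev p y v * ev y q + ev y p * dev q y v.
Proof.
rewrite /dev rsum_mulr rsum_mull -rsum_add.
by apply: eq_bigr => j _; rewrite /= ev_add !ev_mul; ring.
Qed.

Lemma dev_opp p y v : dev (POpp p) y v = - dev p y v.
Proof.
by rewrite -rsum_opp; apply: eq_bigr => j _; rewrite /= ev_opp; ring.
Qed.

Definition devE := (dev_const, dev_var, dev_add, dev_mul, dev_opp).

Lemma eq_dev p y y' v v' :
  (forall i, y i = y' i) -> (forall i, v i = v' i) -> dev p y v = dev p y' v'.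
Proof.
by move=> ey ev'; apply: eq_bigr => j _; rewrite ev'; congr (_ * _); apply: eq_ev.
Qed.

Lemma devD p y v w : dev p y (fun i => v i + w i) = dev p y v + dev p y w.
Proof. by rewrite -rsum_add; apply: eq_bigr => j _; rewrite rmulDr. Qed.

Lemma devZ p y r v : dev p y (fun i => r * v i) = r * dev p y v.
Proof. by rewrite rsum_mull; apply: eq_bigr => j _; ring. Qed.

Lemma dev_sum_poly y v (I : finType) (F : I -> poly R n) :
  dev (\big[@PAdd R n/PConst n 0]_i F i) y v = \sum_i dev (F i) y v.
Proof.
apply: (big_morph (fun p => dev p y v)) => [p q|]; first exact: dev_add.
exact: dev_const.
Qed.

(** For a displacement in an ideal whose square is contained in [I], this is the
    estimate behind the Newton iteration; for [I = 0], it computes tangent vectors. *)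
Lemma taylor (I : R -> Prop) p y d : is_ideal I ->
  (forall i j, I (d i * d j)) ->
  I (ev (fun i => y i + d i) p + - (ev y p + dev p y d)).
Proof.
move=> II Idd; set y' := fun i => _.
have rem0 x : x = 0 -> I x by move=> ->; apply: ideal0.
elim: p => [r|i|p IHp q IHq|p IHp q IHq|p IHp]; rewrite !evE !devE.
- by apply: rem0; ring.
- by apply: rem0; rewrite /y'; ring.
- move: (idealD II IHp IHq); congr I; ring.
- set a := ev y p in IHp *; set b := ev y q in IHq *.
  have Ida : I (dev p y d * dev q y d).
    rewrite {1}/dev rsum_mulr; apply: ideal_sum => // i.
    rewrite /dev rsum_mull; apply: ideal_sum => // j.
    move: (idealMl II (ev y (pderiv i p) * ev y (pderiv j q)) (Idd i j)).
    by congr I; ring.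
  move: (idealMl II (ev y' p) IHq) (idealMl II (b + dev q y d) IHp).
  move=> I1 I2; move: (idealD II Ida (idealD II I1 I2)); congr I; ring.
- move: (idealMl II (ropp 1) IHp); congr I; ring.
Qed.

Lemma taylor_exact p y d : (forall i j, d i * d j = 0) ->
  ev (fun i => y i + d i) p = ev y p + dev p y d.
Proof. by move=> dd; apply: rsub_eq0; apply: (taylor p y (zero_ideal R)). Qed.

Lemma peq_ev p q y : peq p q -> ev y p = ev y q.
Proof.
elim=> {p q} //=; rewrite ?evE; move=> *; rewrite ?evE; try congruence; ring.
Qed.

(** Differentiation is well defined on the free algebra; this is how two linear
    coefficients will be told apart. *)
Lemma peq_dev p q y v : peq p q -> dev p y v = dev q y v.
Proof.
elim=> {p q}.
- by [].
- by move=> p q _ ->.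
- by move=> p q r _ -> _ ->.
- by move=> p p' q q' _ Ep _ Eq; rewrite !devE Ep Eq.
- by move=> p p' q q' ep Ep eq Eq; rewrite !devE Ep Eq (peq_ev y ep) (peq_ev y eq).
- by move=> p p' _ Ep; rewrite !devE Ep.
all: by move=> *; rewrite !devE ?evE; ring.
Qed.

End FixedArity.

Lemma ev_arity0 (y y' : 'I_0 -> R) (p : poly R 0) : ev y p = ev y' p.
Proof. by apply: eq_ev => -[]. Qed.

Fixpoint pren (n n' : nat) (rho : 'I_n -> 'I_n') (p : poly R n) : poly R n' :=
  match p with
  | PConst r => PConst n' r
  | PVar i => PVar R (rho i)
  | PAdd p q => PAdd (pren rho p) (pren rho q)
  | PMul p q => PMul (pren rho p) (pren rho q)
  | POpp p => POpp (pren rho p)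
  end.

Lemma ev_pren (n n' : nat) (rho : 'I_n -> 'I_n') (p : poly R n) y :
  ev y (pren rho p) = ev (fun i => y (rho i)) p.
Proof.
by elim: p => [r|i|p IHp q IHq|p IHp q IHq|p IHp] //=;
  rewrite !evE ?IHp ?IHq.
Qed.

Lemma dev_pren (n n' : nat) (rho : 'I_n -> 'I_n') (p : poly R n) y v :
  dev (pren rho p) y v = dev p (fun i => y (rho i)) (fun i => v (rho i)).
Proof.
by elim: p => [r|i|p IHp q IHq|p IHp q IHq|p IHp] /=;
  rewrite !devE ?ev_pren ?IHp ?IHq.
Qed.

Definition vcat (n k : nat) (u : 'I_n -> R) (w : 'I_k -> R) : 'I_(n + k) -> R :=
  fun i => match split i with inl j => u j | inr l => w l end.

Lemma vcat_l n k (u : 'I_n -> R) (w : 'I_k -> R) j : vcat u w (lshift k j) = u j.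
Proof. by rewrite /vcat -[lshift k j]/(unsplit (inl j)) unsplitK. Qed.

Lemma vcat_r n k (u : 'I_n -> R) (w : 'I_k -> R) l : vcat u w (rshift n l) = w l.
Proof. by rewrite /vcat -[rshift n l]/(unsplit (inr l)) unsplitK. Qed.

Lemma eq_vcat n k (u : 'I_n -> R) (w : 'I_k -> R) v :
  (forall j, u j = v (lshift k j)) -> (forall l, w l = v (rshift n l)) ->
  forall i, vcat u w i = v i.
Proof.
by move=> eu ew i; case: (split_ordP i) => j ->; rewrite ?vcat_l ?vcat_r.
Qed.

Definition jac (l m k : nat) (Q : 'I_l -> poly R (m + k)) (y : 'I_(m + k) -> R)
  (i : 'I_l) (j : 'I_m) : R := ev y (pderiv (lshift k j) (Q i)).

Lemma dev_vcat (m k : nat) (p : poly R (m + k)) y u w :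
  dev p y (vcat u w) = \sum_(j < m) ev y (pderiv (lshift k j) p) * u j
                       + \sum_(l < k) ev y (pderiv (rshift m l) p) * w l.
Proof.
rewrite /dev big_split_ord /=.
by congr (_ + _); apply: eq_bigr => j _; rewrite ?vcat_l ?vcat_r.
Qed.

Lemma jac_mul (l m k : nat) (Q : 'I_l -> poly R (m + k)) y u i :
  \sum_(j < m) jac Q y i j * u j = dev (Q i) y (vcat u (fun=> 0)).
Proof.
by rewrite dev_vcat [X in _ + X]rsum0 ?radd0r // => j; rewrite rmul0r.
Qed.

End Polynomials.

(** * Quotients of polynomial rings *)

Section Homs.

Variables (A B : cring) (f : A -> B) (fhom : ring_hom f).

Add Ring A_ring_hom : (cring_laws A).
Add Ring B_ring_hom : (cring_laws B).

Lemma hom_zero : f 0 = 0.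
Proof.
have H : f 0 + f 0 = f 0 by rewrite -(ring_hom_add fhom) radd0l.
have -> : f 0 = f 0 + f 0 + - f 0 by ring.
by rewrite H; ring.
Qed.

Lemma hom_opp x : f (- x) = - f x.
Proof.
by apply: radd_eq0; rewrite -(ring_hom_add fhom) raddC raddNr hom_zero.
Qed.

End Homs.

Section Presentations.

Variables (setting : extensional_setting) (R : cring).

Lemma lift_op2 (T Q : Type) (pi : T -> Q) (f : T -> T -> T) :
  (forall q, exists x, pi x = q) ->
  (forall x x' y y', pi x = pi x' -> pi y = pi y' -> pi (f x y) = pi (f x' y')) ->
  exists g : Q -> Q -> Q, forall x y, g (pi x) (pi y) = pi (f x y).
Proof.
move=> pi_surj f_congr.
have [|g gP] := @unique_fun setting (Q * Q) Q (fun u s =>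
    exists x y, [/\ pi x = u.1, pi y = u.2 & s = pi (f x y)]).
  move=> [u1 u2] /=; have [[x ex] [y ey]] := (pi_surj u1, pi_surj u2).
  exists (pi (f x y)); split=> [|s [x' [y' [ex' ey' ->]]]]; first by exists x, y.
  by apply: f_congr; rewrite ?ex ?ey.
exists (fun u1 u2 => g (u1, u2)) => x y.
by have [x' [y' [/= ex ey ->]]] := gP (pi x, pi y); apply: f_congr.
Qed.

Lemma poly_quotient (n : nat) (E : poly R n -> poly R n -> Prop) :
  (forall p q, peq p q -> E p q) ->
  (forall p q, E p q -> E q p) ->
  (forall p q r, E p q -> E q r -> E p r) ->
  (forall p p' q q', E p p' -> E q q' -> E (PAdd p q) (PAdd p' q')) ->
  (forall p p' q q', E p p' -> E q q' -> E (PMul p q) (PMul p' q')) ->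
  (forall p p', E p p' -> E (POpp p) (POpp p')) ->
  exists (A : algebra R) (a : 'I_n -> A),
    (forall x, exists p, peval a p = x) /\
    (forall p q, peval a p = peval a q <-> E p q).
Proof.
move=> Epeq Esym Etrans Eadd Emul Eopp.
have Erefl p : E p p by apply/Epeq/peq_refl.
have [Q [pi [pi_surj piE]]] := quotient_exists setting Erefl Esym Etrans.
have pi_peq p q : peq p q -> pi p = pi q by move=> e; apply/piE/Epeq.
have [add addE] : exists g, forall p q, g (pi p) (pi q) = pi (PAdd p q).
  by apply: lift_op2 => // p p' q q' /piE e /piE e'; apply/piE/Eadd.
have [mul mulE] : exists g, forall p q, g (pi p) (pi q) = pi (PMul p q).
  by apply: lift_op2 => // p p' q q' /piE e /piE e'; apply/piE/Emul.
have [opp oppE] : exists g : Q -> Q, forall p, g (pi p) = pi (POpp p).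
  have [g gE] : exists g, forall p q : poly R n, g (pi p) (pi q) = pi (POpp p).
    by apply: lift_op2 => // p p' q q' /piE e _; apply/piE/Eopp.
  by exists (fun u => g u (pi (PConst n 0))) => p; apply: gE.
have laws : ring_theory (pi (PConst n 0)) (pi (PConst n 1)) add mul
    (fun x y => add x (opp y)) opp eq.
  split=> //; repeat (move=> x; case: (pi_surj x) => {x} ? <-);
    rewrite ?(addE, mulE, oppE); apply: pi_peq; by constructor.
pose C := CRing laws.
have str_hom : ring_hom (fun r : R => pi (PConst n r) : C).
  split=> [r s|r s|//]; rewrite /radd /rmul /= ?addE ?mulE; apply: pi_peq;
    by constructor.
exists (Algebra str_hom), (fun i => pi (PVar R i)).
have evpi p : @peval R n (Algebra str_hom) (fun i => pi (PVar R i)) p = pi p.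
  elim: p => [r|i|p IHp q IHq|p IHp q IHq|p IHp] //=; rewrite ?IHp ?IHq.
  - exact: addE.
  - exact: mulE.
  - exact: oppE.
split=> [x|p q]; last by rewrite !evpi.
by have [p <-] := pi_surj x; exists p.
Qed.

Lemma peval_sum (A : algebra R) (n : nat) (a : 'I_n -> A) (I : finType)
    (F : I -> poly R n) :
  peval a (\big[@PAdd R n/PConst n 0]_i F i) = \sum_i peval a (F i).
Proof.
by apply: (big_morph (peval a)) => //=; exact: (hom_zero (structure_map_hom A)).
Qed.

(** In this algebra, identities modulo [peq] become equalities, for which sums over
    finite types are available. *)
Lemma free_algebra_exists (n : nat) :
  exists (F : algebra R) (t : 'I_n -> F),
    (forall x, exists p, peval t p = x) /\
    (forall p q, peval t p = peval t q <-> peq p q).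
Proof.
exact: (poly_quotient (fun p q e => e) (@peq_sym R n) (@peq_trans R n)
  (@peq_add R n) (@peq_mul R n) (@peq_opp R n)).
Qed.

Lemma in_ideal_gen (n l : nat) (P : 'I_l -> poly R n) j : in_ideal P (P j).
Proof.
have [F [t [_ tE]]] := free_algebra_exists n.
exists (fun i => PConst n (if i == j then 1 else 0)); apply/tE.
rewrite peval_sum -(rsum_delta j (fun i => peval t (P i))).
apply: eq_bigr => i _ /=; congr (_ * _); case: eqP => _.
  by rewrite (ring_hom_one (structure_map_hom F)).
by rewrite (hom_zero (structure_map_hom F)).
Qed.

Lemma presentation_exists (n l : nat) (P : 'I_l -> poly R n) :
  exists (A : algebra R) (a : 'I_n -> A), presents P a.
Proof.
have [F [t [t_surj tE]]] := free_algebra_exists n.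
pose J (x : F) := exists c : 'I_l -> F, x = \sum_j c j * peval t (P j).
have JJ : is_ideal J by apply: family_ideal.
pose E p q := J (peval t p + - peval t q).
have [|p q|p q r|p p' q q'|p p' q q'|p p'|A [a [a_surj aE]]] := @poly_quotient n E.
- by move=> p q /tE; rewrite /E => ->; apply: cong_refl.
- exact: cong_sym.
- exact: cong_trans.
- exact: cong_add.
- exact: cong_mul.
- exact: cong_opp.
exists A, a; split=> // p.
have zeroE (B : algebra R) (b : 'I_n -> B) : peval b (PConst n 0) = 0.
  exact: (hom_zero (structure_map_hom B)).
rewrite -(zeroE A a); split=> [/aE [c]|[c pP]].
  rewrite zeroE rsub0 => pE.
  have [c' c'E] := fin_all_exists (fun j => t_surj (c j)).
  exists c'; apply/tE; rewrite pE peval_sum; apply: eq_bigr => j _ /=.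
  by rewrite c'E.
apply/aE; exists (fun j => peval t (c j)).
by rewrite zeroE rsub0 ((tE _ _).2 pP) peval_sum.
Qed.

End Presentations.

(** * Zero loci, and what duality and local choice say about them *)

Definition zeros (R : cring) (n l : nat) (P : 'I_l -> poly R n) : Type :=
  {y : 'I_n -> R | forall i, ev y (P i) = 0}.

Section Duality.

Variables (setting : extensional_setting) (R : cring).

Let funext := setting_funext setting.

Lemma hom_peval (A : algebra R) (n : nat) (a : 'I_n -> A) (x : Spec A) p :
  x (peval a p) = ev (fun i => x (a i)) p.
Proof.
have xhom := spec_hom x.
elim: p => [r|i|p IHp q IHq|p IHp q IHq|p IHp] //=; rewrite ?evE.
- exact: (algebra_hom_scalar xhom).
- by rewrite (ring_hom_add xhom) IHp IHq.
- by rewrite (ring_hom_mul xhom) IHp IHq.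
- by rewrite (hom_opp xhom) IHp.
Qed.

Lemma in_ideal_ev (n l : nat) (P : 'I_l -> poly R n) p y :
  in_ideal P p -> (forall i, ev y (P i) = 0) -> ev y p = 0.
Proof.
move=> [c pE] Py; rewrite (peq_ev y pE) ev_sum; apply: rsum0 => i.
by rewrite ev_mul Py rmul0r.
Qed.

Lemma presents_eq (n l : nat) (P : 'I_l -> poly R n) (A : algebra R) (a : 'I_n -> A)
    p q y :
  presents P a -> (forall i, ev y (P i) = 0) -> peval a p = peval a q ->
  ev y p = ev y q.
Proof.
move=> Pa Py epq; apply: rsub_eq0.
rewrite -ev_opp -ev_add; apply: in_ideal_ev Py.
by apply/(presents_ker Pa); rewrite /= epq raddNr.
Qed.

(** The universal property of a presented algebra. *)
Lemma spec_zeros (n l : nat) (P : 'I_l -> poly R n) (A : algebra R)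
    (a : 'I_n -> A) : presents P a ->
  exists F : Spec A -> zeros P,
    bijective F /\ forall x i, sval (F x) i = x (a i).
Proof.
move=> Pa.
have aP j : peval a (P j) = 0 by apply/(presents_ker Pa)/(in_ideal_gen setting).
have xP (x : Spec A) j : ev (fun i => x (a i)) (P j) = 0.
  by rewrite -hom_peval aP (hom_zero (spec_hom x)).
exists (fun x : Spec A => exist _ (fun i => x (a i) : R) (xP x)); split=> //.
apply: (inj_surj_bij setting) => [x x' /(congr1 sval) /= exx' | [y Py]].
  have {}exx' : spec_fun x = spec_fun x'.
    apply: funext => b; have [p <-] := presents_surj Pa b.
    by rewrite !hom_peval exx'.
  case: x x' exx' => f fhom [f' fhom'] /= eff'.
  by case: f' / eff' fhom' => fhom'; rewrite (proof_irr setting fhom fhom').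
have [|f fE] := @unique_fun setting A R (fun b s =>
    exists p, peval a p = b /\ s = ev y p).
  move=> b; have [p pE] := presents_surj Pa b.
  exists (ev y p); split=> [|s [q [qE ->]]]; first by exists p.
  by apply: (presents_eq Pa Py); rewrite pE qE.
have fev p : f (peval a p) = ev y p.
  by have [q [qE ->]] := fE (peval a p); apply: (presents_eq Pa Py).
have fhom : @algebra_hom R A (regular_algebra R) f.
  split=> [|r]; last exact: (fev (PConst n r)).
  split=> [u v|u v|].
  - have [[p <-] [q <-]] := (presents_surj Pa u, presents_surj Pa v).
    by rewrite -[_ + _]/(peval a (PAdd p q)) !fev.
  - have [[p <-] [q <-]] := (presents_surj Pa u, presents_surj Pa v).
    by rewrite -[_ * _]/(peval a (PMul p q)) !fev.
  - by rewrite -(ring_hom_one (structure_map_hom A)); exact: (fev (PConst n 1)).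
exists (SpecPoint fhom); apply: (sval_inj setting) => /=.
by apply: funext => i; exact: (fev (PVar R i)).
Qed.

Hypothesis dual : duality R.

Lemma presents_fp (n l : nat) (P : 'I_l -> poly R n) (A : algebra R) (a : 'I_n -> A) :
  presents P a -> finitely_presented A.
Proof. by move=> Pa; exists n, l, P, a. Qed.

Lemma dual_in_ideal (n l : nat) (P : 'I_l -> poly R n) p :
  (forall y, (forall i, ev y (P i) = 0) -> ev y p = 0) -> in_ideal P p.
Proof.
move=> p0; have [A [a Pa]] := presentation_exists setting P.
apply/(presents_ker Pa); apply: (bij_inj (dual (presents_fp Pa))).
apply: funext => x; rewrite hom_peval (hom_zero (spec_hom x)).
have [F [_ FE]] := spec_zeros Pa.
rewrite (eq_ev (y' := sval (F x))) => [|i]; last by rewrite FE.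
by apply: p0; exact: (svalP (F x)).
Qed.

(** The surjectivity part of duality. *)
Lemma dual_fun (n l : nat) (P : 'I_l -> poly R n) (f : zeros P -> R) :
  exists p, forall y, f y = ev (sval y) p.
Proof.
have [A [a Pa]] := presentation_exists setting P.
have [F [F_bij FE]] := spec_zeros Pa.
have [ev_inv _ evK] := dual (presents_fp Pa).
have [p pE] := presents_surj Pa (ev_inv (fun x => f (F x))).
exists p => y; have [G GK KG] := F_bij.
have := congr1 (fun h => h (G y)) (evK (fun x => f (F x))) => /=.
rewrite KG -pE hom_peval => <-.
by apply: eq_ev => i; rewrite -FE KG.
Qed.

(** The injectivity part of duality. Only the values of the coefficients matter
    below, so the membership in the ideal is expressed by an identity of functions,
    for equations indexed by any finite type. *)
Lemma nullstellensatz (n : nat) (I : finType) (P : I -> poly R n) p :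
  (forall y, (forall i, ev y (P i) = 0) -> ev y p = 0) ->
  exists c : I -> poly R n, forall y, ev y p = \sum_i ev y (c i) * ev y (P i).
Proof.
move=> p0; have [|c pE] := @dual_in_ideal _ _ (fun j : 'I_#|I| => P (enum_val j)) p.
  by move=> y Py; apply: p0 => i; rewrite -(enum_rankK i); apply: Py.
exists (fun i => c (enum_rank i)) => y; rewrite (peq_ev y pE) ev_sum.
rewrite [RHS](reindex (@enum_val I xpredT)) /=; last first.
  by exists enum_rank => i _; [apply: enum_valK | apply: enum_rankK].
by apply: eq_bigr => j _; rewrite ev_mul enum_valK.
Qed.

(** A closed proposition is the spectrum of a quotient of [R], by equations in no
    variable; this lemma and the next one are duality for this spectrum. *)
Lemma closed_prop_ideal (I : finType) (r : I -> R) (s : R) :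
  ((forall i, r i = 0) -> s = 0) -> exists c : I -> R, s = \sum_i c i * r i.
Proof.
move=> s0; have [|c sE] := @nullstellensatz 0 I (fun i => PConst 0 (r i)) (PConst 0 s).
  by move=> y; exact: s0.
have y0 : 'I_0 -> R by case.
by exists (fun i => ev y0 (c i)); exact: (sE y0).
Qed.

Lemma closed_prop_fun (P : Prop) (l : nat) (r : 'I_l -> R) (f : P -> R) :
  (P <-> forall i, r i = 0) -> exists s, forall h, f h = s.
Proof.
move=> PE; pose f' (y : zeros (fun i => PConst 0 (r i))) := f (PE.2 (svalP y)).
have [p pE] := dual_fun f'.
have y0 : 'I_0 -> R by case.
exists (ev y0 p) => h; rewrite -(ev_arity0 (fun i => y0 i)).
rewrite -(pE (exist _ y0 (PE.1 h))); congr f; exact: (proof_irr setting).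
Qed.

(** * Nonzero elements of the base ring are invertible *)

Hypothesis loc : locality R.

Lemma rone_neq0 : (1 : R) <> 0. Proof. by case: loc. Qed.

(** If [r] is not zero, then the spectrum of [R/r] is empty, and [R/r] is the zero
    ring by duality. *)
Lemma neq0_invertible (r : R) : r <> 0 -> invertible r.
Proof.
move=> r_neq0; have [|c cE] := @closed_prop_ideal 'I_1 (fun=> r) 1.
  by move=> r0; case: r_neq0; exact: (r0 ord0).
by exists (c ord0); rewrite cE big_ord_recl big_ord0 radd0r rmulC.
Qed.

Lemma invertible_neq0 (r : R) : invertible r -> r <> 0.
Proof.
by move=> [s rs] r0; apply: rone_neq0; rewrite -rs r0 rmul0l.
Qed.

Lemma mul_neq0 (r s : R) : r * s <> 0 <-> r <> 0 /\ s <> 0.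
Proof.
split=> [/neq0_invertible rs | [/neq0_invertible r0 /neq0_invertible s0]].
  by split; apply: invertible_neq0;
    [apply: invertible_mull rs | apply: invertible_mulr rs].
exact/invertible_neq0/invertible_mul.
Qed.

Lemma invertible_sum (I : finType) (F : I -> R) :
  invertible (\sum_i F i) -> exists i, invertible (F i).
Proof.
rewrite -big_enum; elim: (enum _) => [|i s IH].
  by rewrite big_nil => /invertible_neq0.
by rewrite big_cons => /(proj2 loc) [inv|/IH //]; exists i.
Qed.

Lemma not_all_zero (I : finType) (r : I -> R) :
  ~ (forall i, r i = 0) -> exists i, invertible (r i).
Proof.
move=> r_neq0; have [|c cE] := @closed_prop_ideal I r 1; first by move/r_neq0.
have [|i /invertible_mulr] := @invertible_sum I (fun i => c i * r i); last by exists i.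
by rewrite -cE; exact: invertible_one.
Qed.

End Duality.

(** * Linear algebra over a ring in which nonzero elements are invertible *)

Definition vcons (T : Type) (n : nat) (z : T) (v : 'I_n -> T) : 'I_n.+1 -> T :=
  fun i => oapp v z (unlift ord0 i).

Lemma vcons0 (T : Type) n (z : T) (v : 'I_n -> T) : vcons z v ord0 = z.
Proof. by rewrite /vcons unlift_none. Qed.

Lemma vconsS (T : Type) n (z : T) (v : 'I_n -> T) j :
  vcons z v (lift ord0 j) = v j.
Proof. by rewrite /vcons liftK. Qed.

Section LinearAlgebra.

Variables (setting : extensional_setting) (R : cring).
Hypotheses (dual : duality R) (loc : locality R).

Add Ring R_ring_lin : (cring_laws R).

Definition app (a b : nat) (M : 'I_b -> 'I_a -> R) (v : 'I_a -> R) (i : 'I_b) : R :=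
  \sum_(j < a) M i j * v j.

Lemma appD a b (M : 'I_b -> 'I_a -> R) u v i :
  app M (fun j => u j + v j) i = app M u i + app M v i.
Proof. by rewrite -rsum_add; apply: eq_bigr => j _; rewrite rmulDr. Qed.

Lemma appZ a b (M : 'I_b -> 'I_a -> R) r v i :
  app M (fun j => r * v j) i = r * app M v i.
Proof. by rewrite rsum_mull; apply: eq_bigr => j _; ring. Qed.

Lemma app_vcons a b (M : 'I_b -> 'I_a.+1 -> R) z v i :
  app M (vcons z v) i = M i ord0 * z + app (fun i j => M i (lift ord0 j)) v i.
Proof.
rewrite /app big_ord_recl vcons0; congr (_ + _).
by apply: eq_bigr => j _; rewrite vconsS.
Qed.

Definition linear_inj a b (M : 'I_b -> 'I_a -> R) : Prop :=
  forall v, (forall i, app M v i = 0) -> forall j, v j = 0.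

Definition linear_surj a b (M : 'I_b -> 'I_a -> R) : Prop :=
  forall c, exists v, forall i, app M v i = c i.

Lemma linear_injE a b (M : 'I_b -> 'I_a -> R) : linear_inj M ->
  forall u v, (forall i, app M u i = app M v i) -> forall j, u j = v j.
Proof.
move=> M_inj u v euv j; apply: rsub_eq0.
have -> : u j + - v j = u j + ropp 1 * v j by ring.
apply: (M_inj (fun j => u j + ropp 1 * v j)) => i.
by rewrite appD appZ euv; ring.
Qed.

(** Gaussian elimination: a column of an injective matrix does not vanish, so that
    it contains a pivot, and clearing this column leaves an injective matrix. *)
Lemma linear_inj_minor a b (M : 'I_b -> 'I_a -> R) : linear_inj M ->
  exists sigma : 'I_a -> 'I_b,
    linear_inj (fun i => M (sigma i)) /\ linear_surj (fun i => M (sigma i)).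
Proof.
elim: a M => [|a IH] M M_inj.
  exists (fun i : 'I_0 => match i with Ordinal _ h => match notF h with end end).
  by split=> [v _ []//|c]; exists (fun=> 0) => -[].
have [i0 [m Mm]] : exists i, invertible (M i ord0).
  apply: (not_all_zero setting dual loc) => M0; apply: (rone_neq0 loc).
  rewrite -[RHS](M_inj (vcons 1 (fun=> 0)) _ ord0) ?vcons0 // => i.
  by rewrite app_vcons M0 rmul0l radd0l; apply: rsum0 => j; rewrite rmul0r.
pose L i j := M i (lift ord0 j).
pose M' i j := L i j + - (M i ord0 * (m * L i0 j)).
have appM' v i : app M' v i = app L v i + - (M i ord0 * (m * app L v i0)).
  rewrite /app !rsum_mull -rsum_opp -rsum_add.
  by apply: eq_bigr => j _; rewrite /M'; ring.
have M'_inj : linear_inj M'.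
  move=> v M'v j; rewrite -[RHS](M_inj (vcons (- (m * app L v i0)) v) _ (lift ord0 j)).
    by rewrite vconsS.
  by move=> i; rewrite app_vcons -/L -[RHS](M'v i) appM'; ring.
have [sigma [s_inj s_surj]] := IH M' M'_inj.
exists (vcons i0 sigma); split=> [v Mv | c].
  have eMv i : app M v i = M i ord0 * v ord0 + app L (fun j => v (lift ord0 j)) i.
    by rewrite /app big_ord_recl.
  have Mv' i : app M v (vcons i0 sigma i) = 0 by exact: Mv.
  have := Mv' ord0; rewrite vcons0 eMv => v0E.
  have v'0 : forall j, v (lift ord0 j) = 0.
    apply: s_inj => i; rewrite -[LHS]/(app M' (fun j => v (lift ord0 j)) (sigma i)).
    have LE : app L (fun j => v (lift ord0 j)) i0 = - (M i0 ord0 * v ord0).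
      by apply: radd_eq0; rewrite raddC.
    rewrite appM' LE.
    have := Mv' (lift ord0 i); rewrite vconsS eMv => <-.
    transitivity (app L (fun j => v (lift ord0 j)) (sigma i)
                  + M i0 ord0 * m * (M (sigma i) ord0 * v ord0)); first ring.
    by rewrite Mm; ring.
  move=> j; case: (unliftP ord0 j) => [j' ->|->] //.
  apply: (invertible_mul_eq0 (x := M i0 ord0)); first by exists m.
  by rewrite -[RHS]v0E [X in _ + X]rsum0 ?radd0r // => j'; rewrite v'0 rmul0r.
pose c' i := c (lift ord0 i) + - (M (sigma i) ord0 * (m * c ord0)).
have [v vE] := s_surj c'.
exists (vcons (m * (c ord0 + - app L v i0)) v) => i.
rewrite -[LHS]/(app M _ (vcons i0 sigma i)) app_vcons -/L.
case: (unliftP ord0 i) => [i' ->|->]; rewrite ?vconsS ?vcons0.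
  have : app M' v (sigma i') = c' i' by exact: vE.
  rewrite appM' /c' => e.
  transitivity (app L v (sigma i') + - (M (sigma i') ord0 * (m * app L v i0))
                + M (sigma i') ord0 * (m * c ord0)); first ring.
  by rewrite e; ring.
rewrite rmulA Mm; ring.
Qed.

Lemma surj_rows_inj a b (M : 'I_b -> 'I_a -> R) (sigma : 'I_a -> 'I_b) :
  linear_surj (fun i => M (sigma i)) -> injective sigma.
Proof.
move=> M_surj i j eij; apply/eqP; case: eqP => // neij; case: (rone_neq0 loc).
have [v vE] := M_surj (fun l => if l == i then 1 else 0).
have := vE i; rewrite eqxx => <-.
rewrite -[LHS]/(app M v (sigma i)) eij -[LHS]/(app (fun i => M (sigma i)) v j) vE.
by case: eqP => // e; case: neij.
Qed.

(** The rows of the invertible minor are pairwise different, so they are all the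
    rows. *)
Lemma square_inj_surj n (M : 'I_n -> 'I_n -> R) : linear_inj M -> linear_surj M.
Proof.
move=> /linear_inj_minor [sigma [_ s_surj]] c.
have [tau sK tK] := injF_bij (surj_rows_inj s_surj).
have [v vE] := s_surj (fun i => c (sigma i)).
by exists v => i; rewrite -(tK i); apply: vE.
Qed.

Lemma square_inverse n (M : 'I_n -> 'I_n -> R) : linear_inj M ->
  exists N : 'I_n -> 'I_n -> R, forall c i, app M (app N c) i = c i.
Proof.
move=> /square_inj_surj M_surj.
have [N NE] := fin_all_exists (fun h : 'I_n =>
  M_surj (fun i => if i == h then 1 else 0)).
exists (fun i h => N h i) => c i; rewrite -[RHS](rsum_delta i c).
rewrite /app /=; under eq_bigr => j _ do rewrite rsum_mull.
rewrite exchange_big; apply: eq_bigr => h _ /=.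
rewrite eq_sym -(NE h i) /app rsum_mulr; apply: eq_bigr => j _; ring.
Qed.

Lemma det_invertible_inj n (M : 'I_n -> 'I_n -> R) :
  invertible (rdet M) <-> linear_inj M.
Proof.
split=> [Mdet v Mv j | M_inj].
  by apply: (invertible_mul_eq0 Mdet); apply: cramer_ker.
have [N NE] := square_inverse M_inj; exists (rdet N).
rewrite -rdet_mul -[RHS](rdet_id R n); apply: eq_rdet => i j.
rewrite -(NE (fun h => if h == j then 1 else 0) i).
apply: eq_bigr => h _; congr (_ * _); rewrite /app.
rewrite -[LHS](rsum_delta j (N h)).
by apply: eq_bigr => l _; rewrite rmulC.
Qed.

End LinearAlgebra.

(** * Open propositions and closed dense propositions *)

Section Propositions.

Variables (setting : extensional_setting) (R : cring).
Hypotheses (dual : duality R) (loc : locality R).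

Add Ring R_ring_prop : (cring_laws R).

Lemma open_stable (U : Prop) : open_prop R U -> ~ ~ U -> U.
Proof.
move=> [n [r rE]] nnU; apply/rE.
have [|i ri] := not_all_zero setting dual loc (r := r); last first.
  by exists i; apply: invertible_neq0.
by move=> r0; apply: nnU => /rE [i]; apply; apply: r0.
Qed.

Lemma nilpotent_not_invertible (r : R) : nilpotent r -> ~ invertible r.
Proof.
move=> [m rm] r_inv; apply: (invertible_neq0 loc (r := rexp r m)) => //.
by elim: m {rm} => [|m IH]; [exact: invertible_one | exact: invertible_mul].
Qed.

Lemma closed_dense_nn (P : Prop) : closed_dense_prop R P -> ~ ~ P.
Proof.
move=> [n [r [r_nil rE]]] nP.
have [|i ri] := not_all_zero setting dual loc (r := r); first by move/rE.
exact: nilpotent_not_invertible (r_nil i) ri.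
Qed.

(** Invertibility is stable under double negation, being equivalent to the
    negation of an equality. *)
Lemma dense_invertible (P : Prop) (x : R) :
  ~ ~ P -> (P -> invertible x) -> invertible x.
Proof.
move=> nnP x_inv; apply: (neq0_invertible setting dual) => x0.
by apply: nnP => /x_inv /(invertible_neq0 loc).
Qed.

Lemma square_zero_nn (r : R) : r * r = 0 -> ~ ~ (r = 0).
Proof.
move=> rr /(neq0_invertible setting dual) r_inv.
by apply: (nilpotent_not_invertible _ r_inv); exists 2; rewrite /= rmul1r.
Qed.

Lemma D1_nn (e : D1 R) : ~ ~ (e = D1_zero R).
Proof.
move=> ne; apply: (square_zero_nn (svalP e)) => e0; apply: ne.
exact: (sval_inj setting).
Qed.

Lemma D2_nn (u : D2 R) : ~ ~ (u = D2_zero R).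
Proof.
move=> ne; case: u ne => [[a b] [aa ab bb]] ne.
apply: (square_zero_nn aa) => /= a0; apply: (square_zero_nn bb) => /= b0; apply: ne.
by apply: (sval_inj setting); rewrite /= a0 b0.
Qed.

(** Clearing the denominators of a polynomial in an inverse of [r]. *)
Lemma clear_denominator (r : R) (p : poly R 1) :
  exists m s, forall z, r * z = 1 -> s = rexp r m * ev (fun=> z) p.
Proof.
elim: p => [a|i|p [m [s sE]] q [m' [s' s'E]]|p [m [s sE]] q [m' [s' s'E]]|
  p [m [s sE]]].
- by exists 0%N, a => z _; rewrite /= rmul1l.
- by exists 1%N, 1 => z rz; rewrite /= rmul1r ev_var.
- exists (m + m')%N, (rexp r m' * s + rexp r m * s') => z rz.
  by rewrite (sE z rz) (s'E z rz) rexpD ev_add; ring.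
- exists (m + m')%N, (s * s') => z rz.
  by rewrite (sE z rz) (s'E z rz) rexpD ev_mul; ring.
- by exists m, (- s) => z rz; rewrite (sE z rz) ev_opp; ring.
Qed.

(** On the part where [r i] is invertible, the function [d] is a fraction with a
    power of [r i] as denominator. *)
Lemma open_prop_sub (U : Prop) (d : U -> R) :
  open_prop R U -> open_prop R (exists h : U, d h <> 0).
Proof.
move=> [n [r rE]].
have dE (i : 'I_n) : exists s : R, forall h : U, r i <> 0 -> (d h <> 0 <-> s <> 0).
  pose P (j : 'I_1) := PAdd (PMul (PConst 1 (r i)) (PVar R j)) (PConst 1 (ropp 1)).
  have PE (y : 'I_1 -> R) : (forall j, ev y (P j) = 0) -> r i * y ord0 = 1.
    by move/(_ ord0); rewrite !evE => e; rewrite (radd_eq0 e); ring.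
  have U_of (y : zeros P) : U.
    apply/rE; exists i; apply/(invertible_neq0 loc)/(invertible_mull (y := sval y ord0)).
    by rewrite (PE _ (svalP y)); exact: invertible_one.
  have [p pE] := dual_fun setting dual (fun y : zeros P => d (U_of y)).
  have [m [s sE]] := clear_denominator (r i) p.
  exists s => h ri_neq0; have [z rz] := neq0_invertible setting dual ri_neq0.
  have Pz j : ev (fun=> z) (P j) = 0 by rewrite !evE rz; ring.
  have -> : d h = ev (fun=> z) p.
    rewrite -(pE (exist _ (fun=> z) Pz)); congr d; exact: (proof_irr setting).
  rewrite (sE z rz) (mul_neq0 setting dual loc).
  suff: rexp (r i) m <> 0 by tauto.
  apply: (invertible_neq0 loc); elim: m {sE} => [|m IH]; first exact: invertible_one.
  by apply: invertible_mul => //; exists z.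
have [s sE] := fin_all_exists dE.
exists n, (fun i => r i * s i); split=> [[h dh] | [i /(mul_neq0 setting dual loc) []]].
  have [i ri] := rE.1 h; exists i; apply/(mul_neq0 setting dual loc).
  by split=> //; apply/(sE i h ri).
move=> ri si; have h : U by apply/rE; exists i.
by exists h; apply/(sE i h ri).
Qed.

Hypothesis zlc : zariski_local_choice R.

(** A cover of the spectrum of a quotient of [R] by nilpotents has a member that
    is everything, because [R] is local. *)
Lemma dense_choice (P : Prop) (B : P -> Type) : closed_dense_prop R P ->
  (forall h, inhabited (B h)) -> inhabited (forall h, B h).
Proof.
move=> P_dense B_inh; have nnP := closed_dense_nn P_dense.
have [l [r [_ rE]]] := P_dense.
pose Pol (i : 'I_l) := PConst 0 (r i).
have [A [a Pa]] := presentation_exists setting Pol.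
have [F [[G GK KG] FE]] := spec_zeros setting Pa.
have [n [f [[c cf] [sec]]]] :=
  zlc (presents_fp Pa) (fun x => B_inh (rE.2 (svalP (F x)))).
have [p pE] := fin_all_exists (fun i => presents_surj Pa (f i)).
have [q qE] := fin_all_exists (fun i => presents_surj Pa (c i)).
have y0 : 'I_0 -> R by case.
have fE (x : Spec A) i : x (f i) = ev y0 (p i).
  by rewrite -pE hom_peval; apply: ev_arity0.
have [i pi_inv] : exists i, invertible (ev y0 (p i)).
  have [|i /invertible_mulr] :=
      invertible_sum loc (F := fun i => ev y0 (q i) * ev y0 (p i)).
    apply: (dense_invertible nnP) => /rE h.
    (* The members generate the unit ideal of the quotient of [R] only, but the sum
       is invertible in [R] because [P] is not false. *)
    rewrite -(_ : 1 = \sum_i ev y0 (q i) * ev y0 (p i)); first exact: invertible_one.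
    rewrite -[LHS]/(ev y0 (PConst 0 1)).
    transitivity (ev y0 (\big[@PAdd R 0/PConst 0 0]_i PMul (q i) (p i))).
      apply: (presents_eq Pa h); rewrite peval_sum /=.
      rewrite (ring_hom_one (structure_map_hom A)) -cf.
      by apply: eq_bigr => i _; rewrite qE pE.
    by rewrite ev_sum; apply: eq_bigr => i _; rewrite ev_mul.
  by exists i.
constructor=> h; pose x := G (exist _ y0 (rE.1 h)).
have x_inv : invertible (x (f i)) by rewrite fE.
rewrite (proof_irr setting h (rE.2 (svalP (F x)))); exact: sec x_inv.
Qed.

(** By duality, the indicator functions of the choices [i] are represented by
    elements of [R]; their sum is invertible, so one of them is, by locality. *)
Lemma dense_constant (P : Prop) (n : nat) (U : 'I_n -> P -> Prop) :
  closed_dense_prop R P -> (forall h, exists i, U i h) -> exists i, forall h, U i h.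
Proof.
move=> P_dense PU; have nnP := closed_dense_nn P_dense.
have [|w] := dense_choice (B := fun h => {i | U i h}) P_dense.
  by move=> h; have [i Uih] := PU h; constructor; exists i.
have [l [r [_ rE]]] := P_dense.
have [e eE] := fin_all_exists (fun i => closed_prop_fun setting dual
  (fun h => if i == sval (w h) then 1 else 0 : R) rE).
have [|i ei] := invertible_sum loc (F := e).
  apply: (dense_invertible nnP) => h.
  rewrite (_ : \sum_i e i = 1); first exact: invertible_one.
  rewrite -[RHS](rsum_delta (sval (w h)) (fun=> 1)).
  by apply: eq_bigr => i _; rewrite rmul1r -(eE i h).
exists i => h; have := eE i h; case: eqP => [-> _|_ e0]; first exact: svalP (w h).
by case: (invertible_neq0 loc ei).
Qed.

End Propositions.

(** * Charts and tangent vectors *)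

(** Charts are maps to [X], and not isomorphisms with a subtype, so that points need
    not be paired with proofs. *)
Definition chart (R : cring) (X : Type) (n l : nat) (P : 'I_l -> poly R n)
    (h : zeros P -> X) : Prop :=
  injective h /\ forall x, open_prop R (exists y, h y = x).

(** The Zariski tangent space: the kernel of the differential of [P] at [y]. *)
Definition tker (R : cring) (n l : nat) (P : 'I_l -> poly R n) (y v : 'I_n -> R) :
    Prop :=
  forall i, dev (P i) y v = 0.

Definition tangent_basis (R : cring) (n l k : nat) (P : 'I_l -> poly R n)
    (y : 'I_n -> R) (K : 'I_n -> 'I_k -> R) : Prop :=
  [/\ linear_inj K, forall u, tker P y (app K u) &
      forall v, tker P y v -> exists u, forall j, app K u j = v j].

Section Tangents.

Variables (setting : extensional_setting) (R : cring).
Hypotheses (dual : duality R) (loc : locality R).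

Add Ring R_ring_tan : (cring_laws R).

Let funext := setting_funext setting.

(** A function on [D1] is a polynomial, whose Taylor expansion at 0 stops at the
    linear term; the same holds on [D2] below. *)
Lemma fun_D1 (f : D1 R -> R) :
  exists b, forall e, f e = f (D1_zero R) + sval e * b.
Proof.
pose P (j : 'I_1) := PMul (PVar R j) (PVar R j).
have [p pE] := dual_fun setting dual
  (fun y : zeros P => f (exist _ (sval y ord0) (svalP y ord0))).
have fE (e : D1 R) : f e = ev (fun=> sval e) p.
  have Pe j : ev (fun=> sval e) (P j) = 0 by exact: (svalP e).
  rewrite -(pE (exist _ (fun=> sval e) Pe)); congr f; exact: (sval_inj setting).
exists (dev p (fun=> 0) (fun=> 1)) => e; rewrite !fE -devZ.
rewrite (eq_ev (y' := fun=> 0 + sval e * 1)) => [|_]; last ring.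
rewrite (taylor_exact p (fun=> 0) (d := fun=> sval e * 1)) // => _ _.
by rewrite !rmul1r (svalP e).
Qed.

Lemma fun_D2 (f : D2 R -> R) : exists b c,
  forall u, f u = f (D2_zero R) + (sval u).1 * b + (sval u).2 * c.
Proof.
pose X := PVar R (@ord0 1); pose Y := PVar R (@ord_max 1).
pose P (j : 'I_3) := nth X [:: PMul X X; PMul X Y; PMul Y Y] j.
pose pt (u : R * R) (i : 'I_2) := if i == ord0 then u.1 else u.2.
pose u_of (y : zeros P) : D2 R := exist _ (sval y ord0, sval y ord_max)
  (And3 (svalP y (@Ordinal 3 0 isT)) (svalP y (@Ordinal 3 1 isT))
        (svalP y (@Ordinal 3 2 isT))).
have [p pE] := dual_fun setting dual (fun y => f (u_of y)).
have fE (u : D2 R) : f u = ev (pt (sval u)) p.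
  have [u11 u12 u22] := svalP u.
  have Pu j : ev (pt (sval u)) (P j) = 0 by case: j => [] [|[|[|j]]].
  rewrite -(pE (exist _ (pt (sval u)) Pu)); congr f; apply: (sval_inj setting).
  by rewrite /= /pt /=; case: (sval u).
exists (ev (fun=> 0) (pderiv ord0 p)), (ev (fun=> 0) (pderiv ord_max p)) => u.
have [u11 u12 u22] := svalP u.
rewrite !fE (eq_ev (y' := fun i => 0 + pt (sval u) i)) => [|i]; last by rewrite radd0l.
rewrite (taylor_exact p (fun=> 0)); last first.
  by move=> i j; rewrite /pt; do 2!case: ifP => _ //; rewrite rmulC.
rewrite (eq_ev (y := pt _) (y' := fun=> 0)) => [|i]; last by rewrite /pt; case: ifP.
rewrite /dev !big_ord_recl big_ord0 /pt /= (_ : lift ord0 ord0 = ord_max).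
  ring.
exact: val_inj.
Qed.

(** Duality turns the hypothesis into a multiple of [X * X] that is equal to
    [(b - c) * X], and the derivative at 0 gives the result. *)
Lemma D1_cancel (b c : R) : (forall e : D1 R, sval e * b = sval e * c) -> b = c.
Proof.
move=> ebc; apply: rsub_eq0; set a := b + - c.
pose P (j : 'I_1) := PMul (PVar R j) (PVar R j).
have [|q qE] := dual_in_ideal setting dual (P := P)
  (p := PMul (PConst 1 a) (PVar R ord0)).
  move=> y Py; rewrite !evE /a.
  have := ebc (exist _ (y ord0) (Py ord0)) => /= e.
  transitivity (y ord0 * b + - (y ord0 * c)); first ring.
  by rewrite e; ring.
have := peq_dev (fun=> 0) (fun=> 1) qE.
rewrite dev_sum_poly !devE !evE rsum0 => [<-|j]; first ring.
by rewrite !devE !evE; ring.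
Qed.

Section Chart.

Variables (X : Type) (n l : nat) (P : 'I_l -> poly R n) (h : zeros P -> X).
Hypothesis h_chart : chart h.

(** Open propositions are stable under double negation, so that an open subtype
    contains the infinitesimal neighbourhoods of its points. *)
Lemma chart_lift (T : Type) (t0 : T) (F : T -> X) (y : zeros P) :
  (forall t, ~ ~ (t = t0)) -> F t0 = h y ->
  exists G : T -> zeros P, G t0 = y /\ forall t, F t = h (G t).
Proof.
move=> nnT Ft0; have [h_inj h_open] := h_chart.
have [|G GE] := @unique_fun setting T (zeros P) (fun t y => F t = h y).
  move=> t; have [y' y'E] : exists y', h y' = F t.
    apply: (open_stable setting dual loc) (h_open _) _ => nF; apply: (nnT t) => tt0.
    by apply: nF; exists y; rewrite tt0.
  by exists y'; split=> // y'' e; apply: h_inj; rewrite y'E.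
by exists G; split=> //; apply: h_inj; rewrite -GE.
Qed.

Lemma zeros_eq (y y' : zeros P) : (forall j, sval y j = sval y' j) -> y = y'.
Proof. by move=> e; apply: (sval_inj setting); apply: funext. Qed.

Section AtPoint.

Variable y : zeros P.
Implicit Types (v w : 'I_n -> R).

Let tker_y := tker P (sval y).

Lemma plane_zero v w : tker_y v -> tker_y w -> forall (u : D2 R) i,
  ev (fun j => sval y j + ((sval u).1 * v j + (sval u).2 * w j)) (P i) = 0.
Proof.
move=> kv kw u i; have [u11 u12 u22] := svalP u.
rewrite taylor_exact => [|j j'].
  by rewrite devD !devZ kv kw (svalP y i); ring.
transitivity ((sval u).1 * (sval u).1 * (v j * v j')
  + (sval u).1 * (sval u).2 * (v j * w j' + w j * v j')
  + (sval u).2 * (sval u).2 * (w j * w j')); first ring.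
by rewrite u11 u12 u22; ring.
Qed.

Definition plane v w (kv : tker_y v) (kw : tker_y w) (u : D2 R) : zeros P :=
  exist _ _ (plane_zero kv kw u).

Lemma line_zero v : tker_y v -> forall (e : D1 R) i,
  ev (fun j => sval y j + sval e * v j) (P i) = 0.
Proof.
move=> kv e i; rewrite taylor_exact => [|j j'].
  by rewrite devZ kv (svalP y i); ring.
transitivity (sval e * sval e * (v j * v j')); first ring.
by rewrite (svalP e); ring.
Qed.

Definition line v (kv : tker_y v) (e : D1 R) : zeros P := exist _ _ (line_zero kv e).

Lemma line_inj v (kv : tker_y v) w (kw : tker_y w) :
  (forall e, h (line kv e) = h (line kw e)) -> forall j, v j = w j.
Proof.
move=> evw j; apply: D1_cancel => e; have [h_inj _] := h_chart.
apply: (radd_cancel (x := sval y j)).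
exact: (congr1 (fun y => sval y j) (h_inj _ _ (evw e))).
Qed.

Lemma tangent_coords (t : tangent R (h y)) :
  exists v (kv : tker_y v), forall e, t e = h (line kv e).
Proof.
have [G [G0 GE]] := chart_lift (D1_nn setting dual loc) (tangent_base t).
have [v vE] := fin_all_exists (fun j => fun_D1 (fun e => sval (G e) j)).
have kv : tker_y v.
  move=> i; apply: D1_cancel => e; rewrite rmul0r -devZ.
  have := svalP (G e) i; rewrite (eq_ev _ (fun j => vE j e)) G0 taylor_exact.
    by rewrite (svalP y i) radd0l.
  move=> j j'; transitivity (sval e * sval e * (v j * v j')); first ring.
  by rewrite (svalP e); ring.
exists v, kv => e; rewrite GE; congr h; apply: zeros_eq => j /=.
by rewrite vE G0.
Qed.

Definition line_tangent v (kv : tker_y v) : tangent R (h y).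
Proof.
by exists (fun e => h (line kv e)); congr h; apply: zeros_eq => j /=; ring.
Defined.

Lemma plane_unique v (kv : tker_y v) w (kw : tker_y w) (psi : D2 R -> X) :
  psi (D2_zero R) = h y ->
  (forall e, psi (D2_axis1 e) = h (line kv e)) ->
  (forall e, psi (D2_axis2 e) = h (line kw e)) ->
  forall u, psi u = h (plane kv kw u).
Proof.
move=> psi0 psi1 psi2; have [h_inj _] := h_chart.
have [G [G0 GE]] := chart_lift (D2_nn setting dual loc) psi0.
have [v' v'E] := fin_all_exists (fun j => fun_D2 (fun u => sval (G u) j)).
have [w' w'E] := fin_all_exists v'E.
have {}G1 e : G (D2_axis1 e) = line kv e by apply: h_inj; rewrite -GE.
have {}G2 e : G (D2_axis2 e) = line kw e by apply: h_inj; rewrite -GE.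
move=> u; rewrite GE; congr h; apply: zeros_eq => j /=; rewrite w'E G0.
have -> : v' j = v j.
  apply: D1_cancel => e; apply: (radd_cancel (x := sval y j)).
  have := w'E j (D2_axis1 e); rewrite G1 G0 /= => ->; ring.
have -> : w' j = w j.
  apply: D1_cancel => e; apply: (radd_cancel (x := sval y j)).
  have := w'E j (D2_axis2 e); rewrite G2 G0 /= => ->; ring.
by ring.
Qed.

End AtPoint.

End Chart.

End Tangents.

Section TangentBasis.

Variables (setting : extensional_setting) (R : cring).
Hypotheses (dual : duality R) (loc : locality R).

Add Ring R_ring_basis : (cring_laws R).

Let funext := setting_funext setting.

Lemma additive_matrix (k n : nat) (f : ('I_k -> R) -> 'I_n -> R) :
  (forall r u j, f (fun i => r * u i) j = r * f u j) ->
  (forall u u' j, f (fun i => u i + u' i) j = f u j + f u' j) ->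
  exists K : 'I_n -> 'I_k -> R, forall u j, f u j = app K u j.
Proof.
move=> fZ fD; pose delta (l i : 'I_k) : R := if l == i then 1 else 0.
exists (fun j l => f (delta l) j) => u j.
have -> : f u j = f (fun i => \big[@radd R/0]_(l <- enum 'I_k) (u l * delta l i)) j.
  congr (f _ j); apply: funext => i; rewrite big_enum /= -[LHS](rsum_delta i u).
  by apply: eq_bigr => l _; rewrite rmulC.
rewrite /app -[RHS]big_enum /=; elim: (enum _) => [|l s IH].
  rewrite [RHS]big_nil -[RHS](rmul0l (f (fun=> 0) j)) -fZ; congr (f _ j).
  by apply: funext => i; rewrite big_nil rmul0r.
rewrite big_cons -IH rmulC -fZ -fD; congr (f _ j).
by apply: funext => i; rewrite big_cons.
Qed.

Lemma tangent_ext (X : Type) (x : X) (t t' : tangent R x) :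
  (forall e, t e = t' e) -> t = t'.
Proof.
case: t t' => f f0 [f' f0'] /= e; have {e}eff' : f = f' by exact: funext.
by case: f' / eff' f0' => f0'; rewrite (proof_irr setting f0 f0').
Qed.

Variables (X : Type) (n l : nat) (P : 'I_l -> poly R n) (h : zeros P -> X).
Hypothesis h_chart : chart h.

(** In a chart, the tangent vectors at [y] are the maps sending [e] to [y + e * v]
    with [v] in the kernel of the differential, and the map on [D2] that defines the
    sum of two of them sends [(a, b)] to [y + a * v + b * w]. *)
Lemma tangent_free_chart (k : nat) (y : zeros P) :
  tangent_free_of_rank R k (h y) <->
  exists K : 'I_n -> 'I_k -> R, tangent_basis P (sval y) K.
Proof.
have coords := tangent_coords setting dual loc h_chart.
have lineI := @line_inj setting _ dual _ _ _ _ _ h_chart y.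
split=> [[phi [[psi phiK psiK] phiZ phiD]] | [K [K_inj kerK K_ker]]].
  have [|f fE] := @unique_fun setting ('I_k -> R) ('I_n -> R) (fun u v =>
      exists kv : tker P (sval y) v, forall e, phi u e = h (line kv e)).
    move=> u; have [v [kv vE]] := coords y (phi u).
    exists v; split=> [|v' [kv' v'E]]; first by exists kv.
    by apply: funext; apply: (lineI _ kv _ kv') => e; rewrite -vE v'E.
  have lineE v (kv : tker P (sval y) v) (v' : 'I_n -> R) (kv' : tker P (sval y) v') e e' :
      (forall j, sval e * v j = sval e' * v' j) -> h (line kv e) = h (line kv' e').
    by move=> evv'; congr h; apply: zeros_eq => // j /=; rewrite evv'.
  have [|u u' j|K KE] := @additive_matrix k n f.
  - move=> r u; have [kv vE] := fE u; have [kv' v'E] := fE (fun i => r * u i).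
    have krv : tker P (sval y) (fun j => r * f u j).
      by move=> i; rewrite devZ kv rmul0r.
    apply: (lineI _ kv' _ krv) => e; rewrite -v'E (phiZ r u e) vE.
    by apply: lineE => j /=; ring.
  - have [kv vE] := fE u; have [kv' v'E] := fE u'.
    have [kw wE] := fE (fun i => u i + u' i).
    have ks : tker P (sval y) (fun j => f u j + f u' j).
      by move=> i; rewrite devD kv kv' radd0l.
    move: j; apply: (lineI _ kw _ ks) => e; rewrite -wE.
    have [chi [[[chi0 chi1 chi2] _] ->]] := phiD u u'.
    rewrite (plane_unique setting dual loc h_chart (kv := kv) (kw := kv') chi0).
    + by congr h; apply: zeros_eq => // j /=; ring.
    + by move=> e'; rewrite chi1 vE.
    + by move=> e'; rewrite chi2 v'E.
  have kerE u v : (forall j, f u j = v j) -> tker P (sval y) v.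
    by move=> e i; have [kv _] := fE u; rewrite -[RHS](kv i); apply: eq_dev.
  exists K; split=> [u Ku j|u|v kv].
  - pose z : 'I_k -> R := fun=> 0.
    suff -> : u = z by [].
    rewrite -[LHS]phiK -[RHS]phiK; congr psi; apply: tangent_ext => e.
    have [kv vE] := fE u; have [kv' v'E] := fE z.
    rewrite vE v'E; apply: lineE => j'.
    by rewrite !KE Ku /app [in RHS]rsum0 // => j''; rewrite rmul0r.
  - by apply: (kerE u) => j; rewrite KE.
  - exists (psi (line_tangent setting h kv)) => j; rewrite -KE.
    have [kv' e] := fE (psi (line_tangent setting h kv)).
    by apply: (lineI _ kv' _ kv) => e'; rewrite -e psiK.
exists (fun u => line_tangent setting h (kerK u)); split.
- apply: (inj_surj_bij setting) => [u u' euu'|t].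
    apply: funext; apply: (linear_injE K_inj); apply: (lineI _ (kerK u) _ (kerK u')) => e.
    exact: (congr1 (fun t => tangent_fun t e) euu').
  have [v [kv vE]] := coords y t; have [u uE] := K_ker v kv.
  exists u; apply: tangent_ext => e; rewrite vE /=; congr h.
  by apply: zeros_eq => // j /=; rewrite uE.
- move=> r u e /=; congr h; apply: zeros_eq => // j /=.
  by rewrite appZ; ring.
- move=> u u'; exists (fun w => h (plane (kerK u) (kerK u') w)); split; last first.
    by move=> e /=; congr h; apply: zeros_eq => // j /=; rewrite appD; ring.
  split=> [|psi [psi0 psi1 psi2]].
    by split=> [|e|e] /=; congr h; apply: zeros_eq => // j /=; ring.
  by apply: funext => w; rewrite (plane_unique setting dual loc h_chart psi0 psi1 psi2).
Qed.

End TangentBasis.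

(** * Schemes and standard smooth schemes in terms of zero loci *)

(** Standard smoothness, pointwise: by [det_invertible_inj], it says that the
    Jacobian determinant is invertible at the points of the zero locus. *)
Definition regular_system (R : cring) (m k : nat) (Q : 'I_m -> poly R (m + k)) : Prop :=
  forall y, (forall i, ev y (Q i) = 0) -> linear_inj (jac Q y).

Section Schemes.

Variables (setting : extensional_setting) (R : cring).
Hypotheses (dual : duality R) (loc : locality R).

Add Ring R_ring_sch : (cring_laws R).

Lemma hom_rdet (A B : cring) (f : A -> B) (n : nat) (M : 'I_n -> 'I_n -> A) :
  ring_hom f -> f (rdet M) = rdet (fun i j => f (M i j)).
Proof.
move=> fhom; rewrite /rdet (big_morph f (ring_hom_add fhom) (hom_zero fhom)).
apply: eq_bigr => s _ /=; case: odd_perm; rewrite ?(hom_opp fhom);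
  by rewrite (big_morph f (ring_hom_mul fhom) (ring_hom_one fhom)).
Qed.

Lemma affine_chart (X : Type) (U : X -> Prop) : affine_scheme R {x | U x} ->
  exists n l (P : 'I_l -> poly R n) (h : zeros P -> X),
    injective h /\ forall x, U x <-> exists y, h y = x.
Proof.
move=> [A [[n [l [P [a Pa]]]] [f [g fK gK]]]].
have [F [[G FK GK] _]] := spec_zeros setting Pa.
exists n, l, P, (fun y => sval (g (G y))); split.
  by move=> y y' /(sval_inj setting) /(can_inj gK) /(can_inj GK).
move=> x; split=> [Ux|[y <-]]; last exact: svalP.
by exists (F (f (exist _ x Ux))); rewrite FK fK.
Qed.

(** By duality, the Jacobian determinant is invertible in the presented algebra as
    soon as its values are: its inverse is the function of the inverse values. *)
Lemma standard_smooth_chart (k : nat) (X : Type) (U : X -> Prop) :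
  standard_smooth_scheme R k {x | U x} <->
  exists m (Q : 'I_m -> poly R (m + k)) (h : zeros Q -> X),
    [/\ regular_system Q, injective h & forall x, U x <-> exists y, h y = x].
Proof.
split=> [[n [Q [A [a [Qa [b ab] [f [g fK gK]]]]]]]|[m [Q [h [Qreg h_inj hU]]]]].
  have [F [[G FK GK] FE]] := spec_zeros setting Qa.
  exists n, Q, (fun y => sval (g (G y))); split.
  - move=> y Qy; apply/(det_invertible_inj setting dual loc).
    pose x := G (exist _ y Qy); exists (x b).
    have := ring_hom_mul (spec_hom x) (rdet (fun i j => peval a (pderiv (lshift k j) (Q i)))) b.
    rewrite ab (ring_hom_one (spec_hom x)) (hom_rdet _ (spec_hom x)) => ->.
    congr (_ * _); apply: eq_rdet => i j; rewrite hom_peval; apply: eq_ev => c.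
    by rewrite -FE GK.
  - by move=> y y' /(sval_inj setting) /(can_inj gK) /(can_inj GK).
  - move=> x; split=> [Ux|[y <-]]; last exact: svalP.
    by exists (F (f (exist _ x Ux))); rewrite FK fK.
have [A [a Qa]] := presentation_exists setting Q.
have [F [[G FK GK] FE]] := spec_zeros setting Qa.
exists m, Q, A, a; split=> //.
  set D := rdet _.
  have xD (x : Spec A) : x D = rdet (jac Q (fun i => x (a i))).
    rewrite (hom_rdet _ (spec_hom x)); apply: eq_rdet => i j; exact: hom_peval.
  have [|inv invE] := @unique_fun setting (Spec A) R (fun x s => x D * s = 1).
    move=> x; have [s sE] : invertible (x D).
      rewrite xD; apply/(det_invertible_inj setting dual loc)/Qreg => i.
      rewrite -[RHS](svalP (F x) i); apply: eq_ev => j; by rewrite FE.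
    exists s; split=> // s' s'E.
    rewrite -[s]rmul1l -s'E (rmulC _ s') -rmulA sE; exact: rmul1r.
  have [ev_inv _ evK] := dual (presents_fp Qa).
  exists (ev_inv inv); apply: (bij_inj (dual (presents_fp Qa))).
  apply: (setting_funext setting) => x.
  rewrite (ring_hom_mul (spec_hom x)) (ring_hom_one (spec_hom x)).
  by rewrite -[RHS](invE x) -[in RHS](evK inv).
have [|f fE] := @unique_fun setting {x | U x} (zeros Q) (fun x y => h y = sval x).
  move=> [x Ux]; have [y yx] := (hU x).1 Ux; exists y; split=> // y' y'x.
  by apply: h_inj; rewrite yx y'x.
exists (fun x => G (f x)); apply: (inj_surj_bij setting) => [x x' /(can_inj GK) fxx'|s].
  by apply: (sval_inj setting); rewrite -!fE fxx'.
have Uh : U (h (F s)) by apply/hU; exists (F s).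
exists (exist _ (h (F s)) Uh); rewrite -[RHS]FK; congr G.
by apply: h_inj; rewrite fE.
Qed.

(** * Standard smooth schemes are formally smooth *)

Section Newton.

Variables (P : Prop) (m k : nat) (Q : 'I_m -> poly R (m + k)) (y0 : 'I_(m + k) -> R).
Hypotheses (P_dense : closed_dense_prop R P) (Q_reg : regular_system Q).
Hypothesis Qy0 : P -> forall i, ev y0 (Q i) = 0.

(** The invariant of the iteration: [y0] is an exact solution when [P] holds, and
    must not be changed in this case. *)
Definition solvable_mod (I : R -> Prop) : Prop :=
  exists y, (P -> forall j, y j = y0 j) /\ forall i, I (ev y (Q i)).

(** The Jacobian matrix stays invertible because it is so when [P] holds and [P] is
    not false. *)
Lemma newton_step (I I' : R -> Prop) : is_ideal I -> is_ideal I' ->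
  (forall a b, I a -> I b -> I' (a * b)) -> solvable_mod I -> solvable_mod I'.
Proof.
move=> II II' mulI [y [Py IQy]].
have J_inj : linear_inj (jac Q y).
  apply/(det_invertible_inj setting dual loc).
  apply: (dense_invertible setting dual loc (closed_dense_nn setting dual loc P_dense)).
  move=> p; apply/(det_invertible_inj setting dual loc)/Q_reg => i.
  by rewrite -[RHS](Qy0 p i); apply: eq_ev; apply: Py.
have [N NE] := square_inverse setting dual loc J_inj.
pose u := app N (fun i => - ev y (Q i)); pose d := vcat u (fun _ : 'I_k => 0).
have Iu j : I (u j).
  apply: ideal_sum => // i; apply: idealMl => //.
  by apply: ideal_eq (idealMl II (ropp 1) (IQy i)) _; ring.
have Id j : I (d j).
  by rewrite /d; case: (split_ordP j) => i ->; rewrite ?vcat_l ?vcat_r //; apply: ideal0.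
exists (fun j => y j + d j); split=> [p j|i].
  have u0 i : u i = 0.
    apply: rsum0 => i'; rewrite (eq_ev _ (Py p)) Qy0 //; ring.
  rewrite -(Py p j) /d; case: (split_ordP j) => i ->;
    rewrite ?vcat_l ?vcat_r ?u0; exact: radd0r.
apply: ideal_eq (taylor (Q i) y II' (d := d) _) _; first by move=> *; apply: mulI.
by rewrite -jac_mul -/(app _ _ _) NE raddNr; ring.
Qed.

(** Nilpotent generators are eliminated one at a time, which avoids the powers of
    an ideal with several generators. *)
Lemma newton_nilpotent (K : R -> Prop) (r : R) : is_ideal K -> nilpotent r ->
  solvable_mod (fun z => exists a, K (z + - (a * r))) -> solvable_mod K.
Proof.
(* The iteration doubles the exponent of [r] modulo [K]; an increment by one is
   enough to reach an exponent for which the power of [r] is zero. *)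
move=> IK [e re]; pose Kt t z := exists a, K (z + - (a * rexp r t)).
have IKt t : is_ideal (Kt t).
  split=> [|z z' [a Ka] [a' Ka']|b z [a Ka]].
  - by exists 0; apply: ideal_eq (ideal0 IK) _; ring.
  - by exists (a + a'); apply: ideal_eq (idealD IK Ka Ka') _; ring.
  - by exists (b * a); apply: ideal_eq (idealMl IK b Ka) _; ring.
move=> S1; have St t : solvable_mod (Kt t.+1).
  elim: t => [|t IH].
    have [y [Py Ky]] := S1; exists y; split=> // i.
    by have [a Ka] := Ky i; exists a; apply: ideal_eq Ka _; rewrite /= rmul1r.
  apply: newton_step IH => // z z' [a Ka] [a' Ka']; exists (a * a' * rexp r t).
  have /= e2 : rexp r t.+2 = r * (r * rexp r t) by [].
  move: (idealD IK (idealMl IK z' Ka) (idealMl IK (a * (r * rexp r t)) Ka')).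
  by move/ideal_eq; apply; rewrite /=; ring.
have [y [Py Ky]] := St e; exists y; split=> // i; have [a Ka] := Ky i.
by apply: ideal_eq Ka _; rewrite /= re; ring.
Qed.

Fixpoint ideal_of_seq (s : seq R) : R -> Prop :=
  if s is r :: s' then fun z => exists a, ideal_of_seq s' (z + - (a * r))
  else fun z => z = 0.

Lemma ideal_of_seqP s : is_ideal (ideal_of_seq s).
Proof.
elim: s => [|r s IH] /=; first exact: zero_ideal.
split=> [|z z' [a Ka] [a' Ka']|b z [a Ka]].
- by exists 0; apply: ideal_eq (ideal0 IH) _; ring.
- by exists (a + a'); apply: ideal_eq (idealD IH Ka Ka') _; ring.
- by exists (b * a); apply: ideal_eq (idealMl IH b Ka) _; ring.
Qed.

Lemma newton_seq (T : Type) (r : T -> R) (s : seq T) : (forall i, nilpotent (r i)) ->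
  solvable_mod (ideal_of_seq (map r s)) -> solvable_mod (fun z => z = 0).
Proof.
move=> r_nil; elim: s => [//|i s IH] /= Ss; apply: IH.
by apply: (newton_nilpotent _ (r_nil i)) => //; exact: ideal_of_seqP.
Qed.

Lemma dense_lift : exists y, (forall i, ev y (Q i) = 0) /\ (P -> forall j, y j = y0 j).
Proof.
have [l [r [r_nil rE]]] := P_dense.
suff [y [Py Qy]] : solvable_mod (fun z => z = 0) by exists y.
apply: (newton_seq (s := enum 'I_l) r_nil); exists y0; split=> // i.
have [|c ->] := closed_prop_ideal setting dual (r := r) (s := ev y0 (Q i)).
  by move/rE => p; exact: Qy0.
rewrite -big_enum /=; elim: (enum _) => [|j s IH]; first by rewrite big_nil.
rewrite big_cons /=; exists (c j); apply: ideal_eq IH _; ring.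
Qed.

End Newton.

Lemma regular_formally_smooth (m k : nat) (Q : 'I_m -> poly R (m + k)) (P : Prop)
    (f : P -> zeros Q) : closed_dense_prop R P -> regular_system Q ->
  exists y, forall p, f p = y.
Proof.
move=> P_dense Q_reg; have [l [r [_ rE]]] := P_dense.
have [y0 y0E] := fin_all_exists (fun j =>
  closed_prop_fun setting dual (fun p => sval (f p) j) rE).
have [|y [Qy yE]] := dense_lift P_dense Q_reg (y0 := y0).
  by move=> p i; rewrite -[RHS](svalP (f p) i); apply: eq_ev => j; rewrite -(y0E j p).
exists (exist _ y Qy) => p; apply: zeros_eq => // j.
by rewrite (y0E j p) /= yE.
Qed.

End Schemes.

(** * Localization, and closed subschemes that are open *)

Section Localization.

Variables (setting : extensional_setting) (R : cring).
Hypotheses (dual : duality R) (loc : locality R).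

Add Ring R_ring_loc : (cring_laws R).

(** The new variable, an inverse of [g], comes first, so that it is one of those
    with respect to which the Jacobian matrix is formed. *)
Definition localized (m k : nat) (Q : 'I_m -> poly R (m + k)) (g : poly R (m + k)) :
    'I_m.+1 -> poly R (m.+1 + k) :=
  vcons (PAdd (PMul (PVar R ord0) (pren (lift ord0) g)) (PConst _ (ropp 1)))
        (fun i => pren (lift ord0) (Q i)).

Section Localized.

Variables (m k : nat) (Q : 'I_m -> poly R (m + k)) (g : poly R (m + k)).

Lemma localizedP (y : 'I_(m + k).+1 -> R) :
  (forall i, ev y (localized Q g i) = 0) <->
  y ord0 * ev (fun j => y (lift ord0 j)) g = 1
  /\ forall i, ev (fun j => y (lift ord0 j)) (Q i) = 0.
Proof.
split=> [Qy|[yg Qy] i].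
  split=> [|i]; last by have := Qy (lift ord0 i); rewrite /localized vconsS ev_pren.
  have := Qy ord0; rewrite /localized vcons0 !evE ev_pren => e.
  by rewrite (radd_eq0 e); ring.
case: (unliftP ord0 i) => [j ->|->]; rewrite /localized ?vconsS ?vcons0 ?ev_pren //.
by rewrite !evE ev_pren yg; ring.
Qed.

Lemma localized_eq (y y' : 'I_(m + k).+1 -> R) :
  (forall i, ev y (localized Q g i) = 0) -> (forall i, ev y' (localized Q g i) = 0) ->
  (forall j, y (lift ord0 j) = y' (lift ord0 j)) -> forall j, y j = y' j.
Proof.
move=> /localizedP [yg _] /localizedP [y'g _] eyy' j.
case: (unliftP ord0 j) => [j' ->|->] //.
rewrite -[LHS]rmul1r -y'g -(eq_ev g eyy').
by rewrite rmulA (rmulC (y _)) -rmulA yg rmul1r.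
Qed.

(** The Jacobian matrix is block triangular, with the blocks [g] and that of [Q]. *)
Lemma localized_regular :
  (forall y, (forall i, ev y (Q i) = 0) -> invertible (ev y g) ->
    linear_inj (jac Q y)) ->
  regular_system (localized Q g).
Proof.
move=> J_inj y Qy v Jv; have [yg Qy'] := (localizedP y).1 Qy.
pose y' j := y (lift ord0 j); pose v' j := v (lift ord0 j).
have vE j : vcat v (fun _ : 'I_k => 0) (lift ord0 j) = vcat v' (fun _ : 'I_k => 0) j.
  case: (split_ordP j) => i ->; rewrite ?vcat_l ?vcat_r.
    by rewrite (_ : lift ord0 _ = lshift k (lift ord0 i)) ?vcat_l //; exact: val_inj.
  by rewrite (_ : lift ord0 _ = rshift m.+1 i) ?vcat_r //; exact: val_inj.
have v0E : vcat v (fun _ : 'I_k => 0) ord0 = v ord0.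
  by rewrite (_ : ord0 = lshift k ord0) ?vcat_l //; exact: val_inj.
have devv i : dev (localized Q g i) y (vcat v (fun=> 0)) = 0.
  by rewrite -jac_mul; apply: Jv.
have g_inv : invertible (ev y' g) by exists (y ord0); rewrite rmulC.
have v'0 : forall j, v' j = 0.
  apply: (J_inj y' Qy' g_inv) => i; rewrite /app jac_mul.
  rewrite -[RHS](devv (lift ord0 i)) /localized vconsS dev_pren.
  by apply: eq_dev => // j; rewrite vE.
move=> j; case: (unliftP ord0 j) => [j' ->|->]; first exact: v'0.
apply: (invertible_mul_eq0 g_inv).
have := devv ord0; rewrite /localized vcons0 !devE !evE ev_pren dev_pren v0E.
rewrite (_ : dev g _ _ = 0) => [e|].
  by rewrite rmulC -[RHS]e rmul0r !radd0r.
transitivity (dev g y' (fun=> 0 * 0)); last by rewrite devZ rmul0l.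
apply: eq_dev => // j'; by rewrite vE rmul0l /vcat; case: split.
Qed.

End Localized.

Lemma poly_of_fun (n : nat) (f : ('I_n -> R) -> R) : exists p, forall y, f y = ev y p.
Proof.
pose P (i : 'I_0) := PConst n (0 : R).
have [p pE] := dual_fun setting dual (fun y : zeros P => f (sval y)).
exists p => y; have Py i : ev y (P i) = 0 by [].
exact: (pE (exist _ y Py)).
Qed.

(** Where the products [P a * P b] vanish, [P = 0] is a closed dense proposition,
    and a lift [x] of the point [y] to [P = 0] differs from [y] by a tangent vector
    of [Q = 0] at [x], hence of [P = 0]; so [P] vanishes at [y] already. By duality,
    the ideal [(P)] is then equal to its square modulo [(Q)], and the determinant
    trick of Nakayama's lemma gives [g]. *)
Lemma closed_smooth_open (n m l : nat) (Q : 'I_m -> poly R n) (P : 'I_l -> poly R n) :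
  let Z x := (forall i, ev x (Q i) = 0) /\ (forall i, ev x (P i) = 0) in
  (forall (D : Prop) (f : D -> 'I_n -> R), closed_dense_prop R D ->
    (forall p, Z (f p)) -> exists x, Z x /\ forall p j, f p j = x j) ->
  (forall x, Z x -> forall v, tker Q x v -> tker P x v) ->
  exists g, forall y, (forall i, ev y (Q i) = 0) ->
    ((forall i, ev y (P i) = 0) <-> invertible (ev y g)).
Proof.
move=> Z Z_smooth Z_tan.
have I_square j y : (forall i, ev y (Q i) = 0) ->
    (forall a b, ev y (P a) * ev y (P b) = 0) -> ev y (P j) = 0.
  move=> Qy PPy; pose D := forall i, ev y (P i) = 0.
  have [||x [[Qx Px] xE]] := Z_smooth D (fun _ => y) => //.
    exists l, (fun i => ev y (P i)); split=> // i.
    by exists 2; rewrite /= rmul1r PPy.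
  pose d i := y i + - x i.
  have d_ideal i : exists c : 'I_l -> R, d i = \sum_a c a * ev y (P a).
    by apply: (closed_prop_ideal setting dual) => p; rewrite /d (xE p) raddNr.
  have [c cE] := fin_all_exists d_ideal.
  have dd i i' : d i * d i' = 0.
    rewrite !cE rsum_mulr; apply: rsum0 => a; rewrite rsum_mull; apply: rsum0 => b.
    transitivity (c i a * c i' b * (ev y (P a) * ev y (P b))); first ring.
    by rewrite PPy rmul0r.
  have yE p : ev y p = ev x p + dev p x d.
    by rewrite -(taylor_exact p x dd); apply: eq_ev => i; rewrite /d; ring.
  have kd : tker Q x d by move=> i; rewrite -[RHS](Qy i) yE Qx radd0l.
  by rewrite yE Px Z_tan ?radd0l.
pose F (i : 'I_m + 'I_l * 'I_l) :=
  match i with inl i => Q i | inr (a, b) => PMul (P a) (P b) end.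
have [c cE] := fin_all_exists (fun j => nullstellensatz setting dual (P := F) (p := P j)
  (fun y Fy => I_square j y (fun i => Fy (inl i)) (fun a b => Fy (inr (a, b))))).
pose C y j b := \sum_(a < l) ev y (c j (inr (a, b))) * ev y (P a).
have CE y j : (forall i, ev y (Q i) = 0) -> ev y (P j) = \sum_(b < l) C y j b * ev y (P b).
  move=> Qy; rewrite cE big_sumType /= rsum0 ?radd0l => [|i]; last by rewrite Qy rmul0r.
  under [RHS]eq_bigr => b _ do rewrite rsum_mulr.
  rewrite exchange_big pair_big /=; apply: eq_bigr => -[a b] _.
  by rewrite ev_mul rmulA.
have [g gE] := poly_of_fun (fun y =>
  rdet (fun j b => (if j == b then 1 else 0) + - C y j b)).
exists g => y Qy; rewrite -gE; split=> [Py|det_inv j].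
  rewrite (eq_rdet (N := fun j b => if j == b then 1 else 0)) => [|j b].
    by rewrite rdet_id; exact: invertible_one.
  rewrite /C rsum0 ?rsub0 // => a; by rewrite Py rmul0r.
apply: (invertible_mul_eq0 det_inv).
apply: (cramer_ker (v := fun b => ev y (P b))) => {}j.
under eq_bigr => b _ do rewrite rmulDl rmulNl.
rewrite rsum_add rsum_opp -CE //.
under eq_bigr => b _ do rewrite eq_sym.
by rewrite rsum_delta raddNr.
Qed.

End Localization.

(** * Smooth affine pieces are covered by standard smooth ones *)

Lemma extend_to_perm (c k : nat) (tau : 'I_k -> 'I_(c + k)) : injective tau ->
  exists pi : 'S_(c + k), forall l, pi (rshift c l) = tau l.
Proof.
move=> tau_inj; pose T := [set tau l | l : 'I_k].
have cardT : #|~: T| = c.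
  have := cardsC T; rewrite card_imset // !card_ord => /eqP.
  by rewrite addnC eqn_add2r => /eqP.
pose f (i : 'I_(c + k)) :=
  match split i with inl j => enum_val (cast_ord (esym cardT) j) | inr l => tau l end.
have f_l j : f (lshift k j) = enum_val (cast_ord (esym cardT) j).
  by rewrite /f -[lshift k j]/(unsplit (inl j)) unsplitK.
have f_r l : f (rshift c l) = tau l.
  by rewrite /f -[rshift c l]/(unsplit (inr l)) unsplitK.
have f_lr j l : f (lshift k j) != f (rshift c l).
  apply/eqP; rewrite f_l f_r => e; have := enum_valP (cast_ord (esym cardT) j).
  by rewrite e inE imset_f.
have f_inj : injective f.
  move=> i i'; case: (split_ordP i) => j ->; case: (split_ordP i') => j' -> e.
  - by move: e; rewrite !f_l => /enum_val_inj /cast_ord_inj ->.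
  - by have := f_lr j j'; rewrite e eqxx.
  - by have := f_lr j' j; rewrite e eqxx.
  - by move: e; rewrite !f_r => /tau_inj ->.
by exists (perm f_inj) => l; rewrite permE f_r.
Qed.

Lemma open_prop_iff (R : cring) (U V : Prop) :
  open_prop R U -> (U <-> V) -> open_prop R V.
Proof. by move=> [n [r rE]] UV; exists n, r; rewrite -UV. Qed.

Section Pieces.

Variables (setting : extensional_setting) (R : cring).
Hypotheses (dual : duality R) (loc : locality R).

Add Ring R_ring_piece : (cring_laws R).

Variables (X : Type) (X_smooth : formally_smooth R X).
Variable k : nat.

Section OnePiece.

Variables (c l : nat) (P : 'I_l -> poly R (c + k)) (h : zeros P -> X).
Hypothesis h_chart : chart h.

Hypothesis h_tan :
  forall y : zeros P, exists K : 'I_(c + k) -> 'I_k -> R, tangent_basis P (sval y) K.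

Variables (sigma : 'I_c -> 'I_l) (pi : 'S_(c + k)).

(** [c] of the equations, after a renaming by which [pi] puts first the variables
    of the minor. *)
Definition minor_system (i : 'I_c) : poly R (c + k) :=
  pren (fun j => (pi^-1)%g j) (P (sigma i)).

Definition minor_locus (x : X) : Prop :=
  exists y, h y = x /\ linear_inj (jac minor_system (fun j => sval y (pi j))).

Lemma minor_locus_open x : open_prop R (minor_locus x).
Proof.
have [h_inj h_open] := h_chart.
have [|s sE] := @unique_fun setting (exists y, h y = x) (zeros P) (fun _ y => h y = x).
  by move=> [y yx]; exists y; split=> // y' y'x; apply: h_inj; rewrite yx.
have := open_prop_sub setting dual loc
  (fun u => rdet (jac minor_system (fun j => sval (s u) (pi j)))) (h_open x).
move/open_prop_iff; apply; split=> [[u du]|[y [yx J_inj]]].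
  exists (s u); split=> //; apply/(det_invertible_inj setting dual loc).
  exact: neq0_invertible.
exists (ex_intro _ y yx); apply: (invertible_neq0 loc).
apply/(det_invertible_inj setting dual loc).
by rewrite (_ : s _ = y) //; apply: h_inj; rewrite sE.
Qed.

(** Two kernels of rank [k], one contained in the other, coincide: an injective
    square matrix is surjective. *)
Lemma minor_tangent (y : zeros P) w :
  linear_inj (jac minor_system (fun j => sval y (pi j))) ->
  tker minor_system (fun j => sval y (pi j)) w ->
  tker P (sval y) (fun j => w ((pi^-1)%g j)).
Proof.
move=> J_inj kw; have [K [K_inj kerK K_ker]] := h_tan y.
set yn := fun j => sval y (pi j) in J_inj kw.
have ker_inj v : tker minor_system yn v -> (forall a, v (rshift c a) = 0) ->
    forall j, v j = 0.
  move=> kv v_r; have v_l : forall j, v (lshift k j) = 0.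
    apply: J_inj => i; rewrite /app jac_mul -[RHS](kv i); apply: eq_dev => // j.
    by apply: eq_vcat.
  by move=> j; case: (split_ordP j) => i ->.
have kerKpi u : tker minor_system yn (fun j => app K u (pi j)).
  move=> i; rewrite dev_pren -[RHS](kerK u (sigma i)).
  by apply: eq_dev => j; rewrite /yn permKV.
have B_inj : linear_inj (fun a => K (pi (rshift c a))).
  move=> u Bu; apply: K_inj => i.
  by rewrite -(permKV pi i); apply: (ker_inj _ (kerKpi u)).
have [u uE] := square_inj_surj setting dual loc B_inj (fun a => w (rshift c a)).
have wE j : app K u (pi j) + ropp 1 * w j = 0.
  apply: (ker_inj (fun j => app K u (pi j) + ropp 1 * w j)) => [i|a].
    by rewrite devD devZ kw (kerKpi u i); ring.
  by rewrite -[app _ _ _]/(app (fun a => K (pi (rshift c a))) u a) uE; ring.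
move=> i; rewrite -[RHS](kerK u i); apply: eq_dev => // j.
have := wE ((pi^-1)%g j); rewrite permKV => e.
by rewrite (radd_eq0 e); ring.
Qed.

(** The equations of the minor define a standard smooth scheme once its determinant
    is inverted. The remaining equations cut out of it a closed subscheme with the
    same tangent spaces, which is open by [closed_smooth_open] and is therefore a
    further localization. *)
Lemma minor_locus_standard : standard_smooth_scheme R k {x | minor_locus x}.
Proof.
have [h_inj h_open] := h_chart.
have [dp dpE] := poly_of_fun setting dual (fun y => rdet (jac minor_system y)).
have dp_inv y : invertible (ev y dp) <-> linear_inj (jac minor_system y).
  by rewrite -dpE; apply: det_invertible_inj.
pose Q1 : 'I_c.+1 -> poly R (c.+1 + k) := localized minor_system dp.
have Q1_reg : regular_system Q1 by apply: localized_regular => // y _ /dp_inv.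
(* In the new variables, the piece is the closed subscheme of [Q1] on which all the
   equations [P] hold. *)
pose P1 i : poly R (c.+1 + k) := pren (fun j => lift ord0 ((pi^-1)%g j)) (P i).
pose Z (y : 'I_(c.+1 + k) -> R) :=
  (forall i, ev y (Q1 i) = 0) /\ (forall i, ev y (P1 i) = 0).
have Z_zero y : Z y -> forall i, ev (fun j => y (lift ord0 ((pi^-1)%g j))) (P i) = 0.
  by move=> [_ P1y] i; rewrite -[RHS](P1y i) ev_pren.
pose pt y (Zy : Z y) : zeros P := exist _ _ (Z_zero y Zy).
have pt_reg y (Zy : Z y) : linear_inj (jac minor_system (fun j => sval (pt y Zy) (pi j))).
  have [Q1y _] := Zy; have [y0 _] := (localizedP _ _ _).1 Q1y.
  apply/dp_inv; exists (y ord0); rewrite rmulC -[RHS]y0; congr (_ * _).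
  by apply: eq_ev => j /=; rewrite permK.
have pt_inj y y' (Zy : Z y) (Zy' : Z y') : pt y Zy = pt y' Zy' -> forall j, y j = y' j.
  move=> e; apply: localized_eq (proj1 Zy) (proj1 Zy') _ => j.
  by have := congr1 (fun u => sval u (pi j)) e; rewrite /= permK.
have pt_surj y : linear_inj (jac minor_system (fun j => sval y (pi j))) ->
    exists x (Zx : Z x), pt x Zx = y.
  move/dp_inv => [z zE]; pose x := vcons z (fun j => sval y (pi j)).
  have xE p : ev (fun j => x (lift ord0 j)) p = ev (fun j => sval y (pi j)) p.
    by apply: eq_ev => j; rewrite /x vconsS.
  have Zx : Z x.
    split=> [|i]; last first.
      rewrite ev_pren -[RHS](svalP y i); apply: eq_ev => j.
      by rewrite /x vconsS permKV.
    apply/localizedP; split=> [|i]; rewrite xE; first by rewrite /x vcons0 rmulC.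
    rewrite ev_pren -[RHS](svalP y (sigma i)); apply: eq_ev => j.
    by rewrite permKV.
  exists x, Zx; apply: zeros_eq => // j /=.
  by rewrite /x vconsS permKV.
have [D f D_dense Zf|x Zx v kv i|g gE] :=
    @closed_smooth_open setting R dual _ _ _ Q1 P1.
- have [x xE] := X_smooth D_dense (fun p => h (pt (f p) (Zf p))).
  have xE' p : x = h (pt (f p) (Zf p)) by exact: (congr1 (fun F => F p) xE).
  have [y [yx J_inj]] : minor_locus x.
    apply: (open_stable setting dual loc) (minor_locus_open x) _ => nW.
    apply: (closed_dense_nn setting dual loc D_dense) => p; apply: nW.
    by rewrite (xE' p); exists (pt (f p) (Zf p)).
  have [x1 [Zx1 x1y]] := pt_surj y J_inj; exists x1; split=> // p.
  apply: (pt_inj _ _ (Zf p) Zx1); apply: h_inj.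
  by rewrite x1y yx (xE' p).
- have km : tker minor_system (fun j => sval (pt x Zx) (pi j))
      (fun j => v (lift ord0 j)).
    move=> i'; rewrite -[RHS](kv (lift ord0 i')) /Q1 /localized vconsS [RHS]dev_pren.
    by apply: eq_dev => j //=; rewrite permK.
  by rewrite dev_pren; exact: (minor_tangent (pt_reg x Zx) km i).
have Q2_Z (y : zeros (localized Q1 g)) : Z (fun j => sval y (lift ord0 j)).
  have [y0 Q1y] := (localizedP _ _ _).1 (svalP y).
  by split=> //; apply/(gE _ Q1y); exists (sval y ord0); rewrite rmulC.
apply/(standard_smooth_chart setting dual loc).
exists c.+2, (localized Q1 g), (fun y => h (pt _ (Q2_Z y))); split.
- by apply: localized_regular => // y Q1y _; apply: Q1_reg.
- move=> y y' /h_inj /pt_inj eyy'; apply: zeros_eq => //.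
  exact: localized_eq (svalP y) (svalP y') eyy'.
- move=> x; split=> [[y [yx J_inj]]|[y <-]]; last by exists (pt _ (Q2_Z y)).
  have [x1 [Zx1 x1y]] := pt_surj y J_inj; have [Q1x1 P1x1] := Zx1.
  have [z zE] := (gE _ Q1x1).1 P1x1.
  have x2E p : ev (fun j => vcons z x1 (lift ord0 j)) p = ev x1 p.
    by apply: eq_ev => j; rewrite vconsS.
  have Q2x2 i : ev (vcons z x1 : 'I_(c.+2 + k) -> R) (localized Q1 g i) = 0.
    move: i; apply/localizedP; split=> [|i]; rewrite x2E // vcons0 rmulC; exact: zE.
  exists (exist _ _ Q2x2); rewrite -yx -x1y; congr h; apply: zeros_eq => // j /=.
  by rewrite vconsS.
Qed.

End OnePiece.

(** The kernel of the differential of [P] is free of rank [k], hence has a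
    complement spanned by basis vectors, on which the differential is injective. *)
Lemma minor_cover (c l : nat) (P : 'I_l -> poly R (c + k)) (h : zeros P -> X) y :
  (exists K : 'I_(c + k) -> 'I_k -> R, tangent_basis P (sval y) K) ->
  exists (sigma : {ffun 'I_c -> 'I_l}) (pi : 'S_(c + k)),
    minor_locus h sigma pi (h y).
Proof.
move=> [K [K_inj kerK K_ker]].
have [tau [tau_inj tau_surj]] := linear_inj_minor setting dual loc K_inj.
have [pi piE] := extend_to_perm (surj_rows_inj loc tau_surj).
pose M := jac (fun i => pren (fun j => (pi^-1)%g j) (P i)) (fun j => sval y (pi j)).
have M_inj : linear_inj M.
  move=> v Mv j; pose w := vcat v (fun _ : 'I_k => 0).
  have kw : tker P (sval y) (fun i => w ((pi^-1)%g i)).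
    move=> i; rewrite -[RHS](Mv i) /app jac_mul dev_pren.
    by apply: eq_dev => i'; rewrite ?permKV.
  have [u uE] := K_ker _ kw.
  have u0 : forall a, u a = 0.
    apply: tau_inj => a; rewrite -[LHS]/(app K u (tau a)) uE -piE permK.
    exact: vcat_r.
  have := uE (pi (lshift k j)); rewrite permK /w vcat_l => <-.
  by apply: rsum0 => a; rewrite u0 rmul0r.
have [sigma [s_inj _]] := linear_inj_minor setting dual loc M_inj.
exists [ffun i => sigma i], pi, y; split=> // v Jv; apply: s_inj => i.
rewrite -[RHS](Jv i); apply: eq_bigr => j _.
by rewrite /jac /minor_system ffunE.
Qed.

Lemma affine_piece_cover (n l : nat) (P : 'I_l -> poly R n) (h : zeros P -> X) :
  chart h ->
  (forall y : zeros P, exists K : 'I_n -> 'I_k -> R, tangent_basis P (sval y) K) ->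
  exists (I : finType) (W : I -> X -> Prop),
    [/\ forall i x, open_prop R (W i x), forall i, standard_smooth_scheme R k {x | W i x}
      & forall y, exists i, W i (h y)].
Proof.
move=> h_chart h_tan.
have [le_kn|lt_nk] := leqP k n; last first.
  (* No point has a tangent space of rank greater than the number of variables. *)
  exists 'I_0, (fun _ _ => False); split=> [[]//|[]//|y].
  have [K [K_inj _ _]] := h_tan y.
  have [tau [_ tau_surj]] := linear_inj_minor setting dual loc K_inj.
  have := leq_card _ (surj_rows_inj loc tau_surj).
  by rewrite !card_ord leqNgt lt_nk.
have [c nE] : exists c, n = (c + k)%N by exists (n - k)%N; rewrite subnK.
subst n; exists ({ffun 'I_c -> 'I_l} * 'S_(c + k))%type.
exists (fun i : {ffun 'I_c -> 'I_l} * 'S_(c + k) => minor_locus h i.1 i.2).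
split=> [i x|i|y].
- exact: minor_locus_open.
- exact: minor_locus_standard.
- by have [sigma [pi yW]] := minor_cover h (h_tan y); exists (sigma, pi).
Qed.

End Pieces.

(** * Smoothness of a given dimension and standard smooth covers *)

Section Smoothness.

Variables (setting : extensional_setting) (R : cring).
Hypotheses (dual : duality R) (loc : locality R) (zlc : zariski_local_choice R).

Add Ring R_ring_smooth : (cring_laws R).

Lemma cover_by_finType (C : Type -> Prop) (X : Type) (I : finType) (W : I -> X -> Prop) :
  (forall i x, open_prop R (W i x)) -> (forall x, exists i, W i x) ->
  (forall i, C {x | W i x}) -> has_finite_open_cover_by R C X.
Proof.
move=> W_open W_cover W_C; exists #|I|, (fun j => W (enum_val j)); split=> // x.
by have [i Wi] := W_cover x; exists (enum_rank i); rewrite enum_rankK.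
Qed.

Variables (k : nat) (X : Type).

Lemma smooth_standard_cover : scheme R X -> smooth_scheme_of_dim R k X ->
  has_finite_open_cover_by R (standard_smooth_scheme R k) X.
Proof.
move=> [N [U [U_open U_cover U_aff]]] [[_ X_smooth] X_tan].
have [I [W WP]] : exists (I : 'I_N -> finType) (W : forall i, I i -> X -> Prop),
    forall i, [/\ forall j x, open_prop R (W i j x),
      forall j, standard_smooth_scheme R k {x | W i j x}
      & forall x, U i x -> exists j, W i j x].
  suff cover_U i : exists (I : finType) (W : I -> X -> Prop),
      [/\ forall j x, open_prop R (W j x),
        forall j, standard_smooth_scheme R k {x | W j x}
        & forall x, U i x -> exists j, W j x].
    have [I IP] := fin_all_exists cover_U; exists I; exact: fin_all_exists IP.
  have [n [l [P [h [h_inj hU]]]]] := affine_chart setting (U_aff i).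
  have h_chart : chart h by split=> // x; apply: open_prop_iff (U_open i x) (hU x).
  have [y|I [W [W_open W_std W_cover]]] :=
      affine_piece_cover setting dual loc X_smooth (k := k) h_chart.
    exact/(tangent_free_chart setting dual loc h_chart).
  by exists I, W; split=> // x /hU [y <-].
apply: (@cover_by_finType _ _ {i & I i} (fun s => W (tag s) (tagged s))) => [[i j] x|x|[i j]].
- by have [+ _ _] := WP i; apply.
- have [i Ux] := U_cover x; have [_ _ /(_ x Ux) [j Wx]] := WP i.
  by exists (Tagged I j).
- by have [_ + _] := WP i; apply.
Qed.

(** A partial point is contained in a single member of the cover, by
    [dense_constant], so that it can be lifted there. *)
Lemma standard_cover_smooth :
  has_finite_open_cover_by R (standard_smooth_scheme R k) X ->
  formally_smooth R X /\ forall x : X, tangent_free_of_rank R k x.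
Proof.
move=> [N [U [U_open U_cover U_std]]]; split=> [P P_dense f|x].
  have [i Uf] := dense_constant setting dual loc zlc (U := fun i p => U i (f p))
    P_dense (fun p => U_cover (f p)).
  have [m [Q [h [Q_reg h_inj hU]]]] :=
    (standard_smooth_chart setting dual loc k (U i)).1 (U_std i).
  have [|g gE] := @unique_fun setting P (zeros Q) (fun p y => h y = f p).
    move=> p; have [y yE] := (hU (f p)).1 (Uf p); exists y; split=> // y' y'E.
    by apply: h_inj; rewrite yE y'E.
  have [y yE] := regular_formally_smooth setting dual loc g P_dense Q_reg.
  by exists (h y); apply: (setting_funext setting) => p; rewrite -gE yE.
have [i Ux] := U_cover x.
have [m [Q [h [Q_reg h_inj hU]]]] :=
  (standard_smooth_chart setting dual loc k (U i)).1 (U_std i).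
have h_chart : chart h by split=> // x'; apply: open_prop_iff (U_open i x') (hU x').
have [y <-] := (hU x).1 Ux; apply/(tangent_free_chart setting dual loc h_chart).
have J_inj := Q_reg _ (svalP y); set J := jac Q (sval y) in J_inj.
have [S SE] := square_inverse setting dual loc J_inj.
(* The last [k] coordinates [u] of a tangent vector determine the others: they are
   the solution of a linear system with the invertible matrix [J]. *)
pose H i (a : 'I_k) := ev (sval y) (pderiv (rshift m a) (Q i)).
have dQ v w i' : dev (Q i') (sval y) (vcat v w) = app J v i' + app H w i'.
  exact: dev_vcat.
pose T u := vcat (app S (fun i' => - app H u i')) u.
have dQT u i' : dev (Q i') (sval y) (T u) = 0 by rewrite dQ SE raddC raddNr.
have [r u j|u u' j|K KE] := @additive_matrix setting R k (m + k) T.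
- rewrite /T; case: (split_ordP j) => a ->; rewrite ?vcat_l ?vcat_r // -appZ.
  by apply: eq_bigr => a' _; congr (_ * _); rewrite appZ; ring.
- rewrite /T; case: (split_ordP j) => a ->; rewrite ?vcat_l ?vcat_r // -appD.
  by apply: eq_bigr => a' _; congr (_ * _); rewrite appD; ring.
exists K; split=> [u Ku a|u i'|v kv].
- by rewrite -[RHS](Ku (rshift m a)) -KE; exact/esym/vcat_r.
- by rewrite -[RHS](dQT u i'); apply: eq_dev => // j; rewrite KE.
exists (fun a => v (rshift m a)) => j; rewrite -KE; move: j; apply: eq_vcat => // j.
apply: (linear_injE J_inj (v := fun j => v (lshift k j))) => i'.
apply: (radd_cancel (x := app H (fun a => v (rshift m a)) i')).
rewrite raddC -dQ dQT raddC -dQ -[LHS](kv i'); apply: eq_dev => // j'.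
by apply/esym; move: j'; apply: eq_vcat.
Qed.

End Smoothness.

Theorem proposition4p4p1 (setting : extensional_setting) (R : cring)
    (loc : locality R) (dual : duality R) (zlc : zariski_local_choice R)
    (k : nat) (X : Type) (X_scheme : scheme R X) :
  smooth_scheme_of_dim R k X <->
  has_finite_open_cover_by R (standard_smooth_scheme R k) X.
Proof.
split=> [|cover]; first exact: smooth_standard_cover.
by have [X_smooth X_tan] := standard_cover_smooth setting dual loc zlc cover.
Qed.
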